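(* Let $\alpha\in(0,1)$, $\sigma\ge0$, $u_0\in\hat H^\sigma(\Omega)$ and $f=0$. Let $u$ be the solution of the sub-diffusion problem, $\mathbf u(t)=\mathcal I_Nu(t)$, and let $\mathbf u_{h,p}(t)$ be the solution of the modified central finite difference scheme with mesh size $h=1/N$. Then there is a constant $C>0$, independent of $h$, $t$ and $u_0$, such that for all $t\in(0,T]$ $$\|\mathbf u(t)-\mathbf u_{h,p}(t)\|_{l^\infty}\le Ch^{\min(\sigma+\frac32,\,2)}\,\ell_h^{\chi_0(\frac14-\frac\sigma2)}\,t^{-\alpha}\|u_0\|_{\hat H^\sigma(\Omega)}$$ and $$\|\mathbf u(t)-\mathbf u_{h,p}(t)\|_{l^2}\le Ch^2t^{-\alpha}\|u_0\|_{\hat H^\sigma(\Omega)}.$$ Here $\ell_h=|\ln h|^{1/2}$, and $\chi_0(x)=1$ if $x=0$, $\chi_0(x)=0$ if $x\ne0$.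
   Context: Setting: $\Omega=(0,1)$, $T>0$, $A=-\Delta$ on $\Omega$ with homogeneous Dirichlet boundary condition, with eigenvalues $\lambda_k=k^2\pi^2$ and eigenfunctions $\phi_k(x)=\sqrt2\sin(k\pi x)$, $k\ge1$. For $s\ge0$, $\hat H^s(\Omega)=\{v\in L^2(\Omega):\|v\|_{\hat H^s(\Omega)}<\infty\}$ with $\|v\|_{\hat H^s(\Omega)}^2=\sum_{k\ge1}\lambda_k^s(v,\phi_k)^2$, where $(\cdot,\cdot)$ is the $L^2(\Omega)$ inner product. Sub-diffusion problem: ${}_0\partial_t^\alpha(u-u_0)+Au=f$ in $\Omega\times(0,T]$, $u=0$ on $\partial\Omega\times(0,T]$, $u(0)=u_0$, where ${}_0\partial_t^\alpha u=\frac1{\Gamma(1-\alpha)}\frac{\partial}{\partial t}\int_0^t(t-\xi)^{-\alpha}u(\xi)\,d\xi$ is the Riemann–Liouville derivative. For $f=0$ its solution is represented as $$u(x,t)=\frac1{2\pi\mathbf i}\int_{\Gamma_\theta}e^{zt}z^{\alpha-1}\sum_{i=1}^\infty(z^\alpha+\lambda_i)^{-1}\phi_i(x)(\phi_i,u_0)\,dz,$$ where $\Gamma_\theta=\{z\in\mathbb C:|\arg z|=\theta,\ |z|>0\}$, $\theta\in(\pi/2,\pi)$, oriented with increasing imaginary part. Discretization: $N\in\mathbb N^*$, $h=1/N$, $x_i=i/N$; for a function $v$, $\mathcal I_Nv=[v(x_1),\dots,v(x_{N-1})]^T$. $P_N$ is the $L^2$-projection $P_Nv=\sum_{k=1}^{N-1}(v,\phi_k)\phi_k$.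 $\mathbf A=[N^2w_{i,j}]_{i,j=1}^{N-1}$ with $w_{i,i}=2$, $w_{i,j}=-1$ if $|i-j|=1$, $w_{i,j}=0$ if $|i-j|>1$. The modified central finite difference scheme is ${}_0\partial_t^\alpha(\mathbf u_{h,p}-\mathbf u_p^0)+\mathbf A\mathbf u_{h,p}=\mathbf f_p$ with $\mathbf u_p^0=\mathcal I_N(P_Nu_0)$, $\mathbf f_p=\mathcal I_N(P_Nf)$ and unknown $\mathbf u_{h,p}(t)\in\mathbb R^{N-1}$; for $f=0$ its solution is $\mathbf u_{h,p}(t)=\frac1{2\pi\mathbf i}\int_{\Gamma_\theta}e^{zt}z^{\alpha-1}(z^\alpha+\mathbf A)^{-1}\mathbf u_p^0\,dz$. Discrete norms: for $\mathbf v\in\mathbb R^M$, $\|\mathbf v\|_{l^2}^2=\frac1M\sum_{k=1}^Mv_k^2$, $\|\mathbf v\|_{l^\infty}=\max_{1\le k\le M}|v_k|$. *)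

(* Defs.v *)
From mathcomp Require Export all_boot all_order all_algebra.
From mathcomp Require Export complex.
From mathcomp Require Export all_classical all_reals all_analysis.
Export Order.TTheory GRing.Theory Num.Theory.
Export numFieldNormedType.Exports.

Set Implicit Arguments.
Unset Strict Implicit.
Unset Printing Implicit Defensive.

Local Open Scope classical_set_scope.
Local Open Scope complex_scope.
Local Open Scope ring_scope.

Section ComplexAnalysis.
Variable R : realType.
Implicit Types (z : R[i]) (a x : R).

Definition cexp z : R[i] :=
  (expR (complex.Re z))%:C
  * (cos (complex.Im z) +i* sin (complex.Im z)).

(* Principal argument, with values in ]-pi, pi] for z != 0. *)
Definition Arg z : R :=
  let c := complex.Re z / ComplexField.Normc.normc z in
  if 0 <= complex.Im z then acos c else - acos c.

(* Principal branch of z ^ a; only used for z != 0. *)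
Definition cpow z a : R[i] :=
  (ComplexField.Normc.normc z `^ a)%:C
  * (cos (a * Arg z) +i* sin (a * Arg z)).

Definition cseries (F : nat -> R[i]) : R[i] :=
  (limn (fun n => \sum_(1 <= k < n) complex.Re (F k)))
  +i* (limn (fun n => \sum_(1 <= k < n) complex.Im (F k))).

Definition cintegral_pos (g : R -> R[i]) : R[i] :=
  (\int[lebesgue_measure]_(r in `]0, +oo[) complex.Re (g r))
  +i* (\int[lebesgue_measure]_(r in `]0, +oo[) complex.Im (g r)).

Definition ray (theta r : R) : R[i] := (r * cos theta) +i* (r * sin theta).

(* Integral along {|arg z| = theta, |z| > 0}, from infinity * e^(- i theta)
   to 0 and then to infinity * e^(i theta) (increasing imaginary part); the
   incoming half is parametrised by the modulus, hence its minus sign. *)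
Definition contour_integral (theta : R) (g : R[i] -> R[i]) : R[i] :=
  cintegral_pos (fun r => g (ray theta r) * ray theta 1)
  - cintegral_pos (fun r => g (ray (- theta) r) * ray (- theta) 1).

End ComplexAnalysis.

Section Spaces.
Variable R : realType.
Implicit Types (v w : R -> R) (s : R).

Definition Omega : set R := `]0, 1[.

Definition lambda (k : nat) : R := k%:R ^+ 2 * pi ^+ 2.

Definition phi (k : nat) (x : R) : R := Num.sqrt 2 * sin (k%:R * pi * x).

Definition inner v w : R := \int[lebesgue_measure]_(x in Omega) (v x * w x).

Definition L2 v : Prop :=
  measurable_fun Omega v /\
  (\int[lebesgue_measure]_(x in Omega) ((v x ^+ 2)%:E) < +oo)%E.

Definition Hhat_sqnorm s v : \bar R :=
  (\sum_(1 <= k <oo) ((lambda k `^ s * inner v (phi k) ^+ 2)%:E))%E.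

Definition Hhat s v : Prop := L2 v /\ (Hhat_sqnorm s v < +oo)%E.

Definition Hhat_norm s v : R := Num.sqrt (fine (Hhat_sqnorm s v)).

End Spaces.

Section Discretization.
Variable R : realType.

(* Row i of a vector of length N.-1 stands for the index i + 1 and the node
   (i + 1) / N. *)
Definition interp (N : nat) (v : R -> R) : 'cV[R]_(N.-1) :=
  \col_(i < N.-1) v (i.+1%:R / N%:R).

Definition L2proj (N : nat) (v : R -> R) : R -> R :=
  fun x => \sum_(1 <= k < N) inner v (phi k) * phi k x.

Definition fdmx (N : nat) : 'M[R]_(N.-1) :=
  \matrix_(i < N.-1, j < N.-1)
    (N%:R ^+ 2 * (if (i == j :> nat) then 2
                  else if (i.+1 == j :> nat) || (j.+1 == i :> nat) then -1
                  else 0)).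

Definition norm_l2 (M : nat) (v : 'cV[R]_M) : R :=
  Num.sqrt (M%:R^-1 * \sum_(k < M) v k 0 ^+ 2).

Definition norm_linf (M : nat) (v : 'cV[R]_M) : R :=
  \big[Num.max/0]_(k < M) `|v k 0|.

Definition chi0 (x : R) : R := if x == 0 then 1 else 0.

Definition ell (h : R) : R := `|ln h| `^ (1 / 2).

End Discretization.

Section Solutions.
Variable R : realType.
Implicit Types (T alpha theta : R).

(* The solution of the homogeneous problem
     D_t^alpha (u - u0) - u_xx = 0 in Omega x ]0, T], u = 0 at x = 0 and x = 1,
     u(0) = u0  (D_t^alpha the Riemann-Liouville derivative),
   which for u0 merely in L^2(Omega) is understood through its inverse Laplace
   transform.  The right-hand side is real by the symmetry of the contour. *)
Definition subdiffusion_solution T alpha theta (u0 : R -> R) (u : R -> R -> R) : Prop :=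
  forall x t : R, 0 <= x <= 1 -> 0 < t <= T ->
    (u x t)%:C =
    (2 * pi%:C * 'i%C)^-1 *
    contour_integral theta (fun z =>
      cexp (t%:C * z) * cpow z (alpha - 1) *
      cseries (fun i => (cpow z alpha + (lambda R i)%:C)^-1
                        * (phi i x)%:C * (inner (phi i) u0)%:C)).

(* Same reading of the semi-discrete system
     D_t^alpha (u_h - u_p^0) + A u_h = 0,  u_p^0 = I_N (P_N u0). *)
Definition scheme_solution T alpha theta (u0 : R -> R) (N : nat)
    (uh : R -> 'cV[R]_(N.-1)) : Prop :=
  let A := map_mx (real_complex R) (fdmx R N) in
  let up0 := map_mx (real_complex R) (interp N (L2proj N u0)) in
  forall (t : R) (i : 'I_(N.-1)), 0 < t <= T ->
    (uh t i 0)%:C =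
    (2 * pi%:C * 'i%C)^-1 *
    contour_integral theta (fun z =>
      cexp (t%:C * z) * cpow z (alpha - 1) *
      (invmx ((cpow z alpha)%:M + A) *m up0) i 0).

End Solutions.

(* Main.v *)
Require Import Defs.
From mathcomp Require Import ring lra zify measurable_realfun.

(** Expand everything in the sine modes phi_k, with c_k = (u_0, phi_k).  On the
grid x_i = i/N the first N-1 modes are eigenvectors of the finite difference
matrix, with eigenvalues mu_k = 4 N^2 sin^2 (k pi / (2 N)) in place of
lambda_k = k^2 pi^2 ([fdmx_phi], [fdmx_resolvent]).  So at a point z of the
contour, with w = z^alpha, the integrands of the two solutions at a node differ,
up to the factor e^(zt) z^(alpha-1), by a series in a_k c_k phi_k(x_i), where
a_k = 1/(w + lambda_k) - 1/(w + mu_k) for k < N and a_k = 1/(w + lambda_k) for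
k >= N.

The point of the proof is a bound on a_k that is uniform in z.  The argument
of w is plus or minus alpha theta, which stays away from pi, hence
|w + l| >= s l for all l >= 0, with s = sin (alpha theta).  Together with
lambda_k / 4 <= mu_k and lambda_k - mu_k = O(lambda_k^2 / N^2) this gives
|a_k| <= s^-2 / max(k, N)^2 for every k ([normc_resolvent_gap_le]).

What remains at fixed z is real analysis of sine sums at the nodes.
- Maximum norm: Cauchy-Schwarz against the norm of u_0 leaves the sum of
  k^(-2 sigma) / max(k, N)^4, whose size is N^(-3-2 sigma), N^-4 ln N or N^-4
  according as sigma is less than, equal to, or greater than 1/2.  This is
  where the rate and the logarithm come from ([sum_mode_weight_le]).
- l^2 norm: the same argument would lose half a power of h on the modes k >= N.
  Cut the frequencies into blocks [mN, (m+1)N).  On the grid each block is, up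
  to the sign (-1)^(mi), a sum of the first N modes, which are orthogonal there;
  block m therefore contributes at most a constant times s^-2 N^-2 / (m+1) times
  the l^2 norm of its coefficients, and by Cauchy-Schwarz these contributions
  add up over m ([node_sum_l2]).

Finally the norm of an integral is at most the integral of the norm
([Rintegral_l2_le], of which the bound at one node is the case of a family with
one member), and the integral of |e^(zt) z^(alpha-1)| |dz| is at most a constant
times t^-alpha ([expkernel_integral_le]).  Since the modes are summed before the
integration, series and integral are never exchanged. *)

Set Implicit Arguments.
Unset Strict Implicit.
Unset Printing Implicit Defensive.

Local Open Scope classical_set_scope.
Local Open Scope ring_scope.

(** * Finite sums, and the sine modes at the grid points *)

Section FiniteSums.
Variable R : realType.

(** Cauchy-Schwarz. *)
Lemma sqr_sum_le (I : Type) (s : seq I) (P : pred I) (f g : I -> R) :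
  (\sum_(i <- s | P i) f i * g i) ^+ 2 <=
  (\sum_(i <- s | P i) f i ^+ 2) * (\sum_(i <- s | P i) g i ^+ 2).
Proof.
elim: s => [|x s IH]; first by rewrite !big_nil expr0n mul0r.
rewrite !big_cons; case: (P x) => //.
set A := \sum_(i <- s | P i) f i ^+ 2 in IH *.
set B := \sum_(i <- s | P i) g i ^+ 2 in IH *.
set Z := \sum_(i <- s | P i) _ in IH *.
have A0 : 0 <= A by apply: sumr_ge0 => i _; exact: sqr_ge0.
have B0 : 0 <= B by apply: sumr_ge0 => i _; exact: sqr_ge0.
have cross : 2 * (f x * g x) * Z <= A * g x ^+ 2 + B * f x ^+ 2.
  apply: le_trans (ler_norm _) _.
  have R0 : 0 <= A * g x ^+ 2 + B * f x ^+ 2.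
    by rewrite addr_ge0 // mulr_ge0 // sqr_ge0.
  rewrite -(ler_pXn2r (n := 2)) ?nnegrE // -normrX ger0_norm ?sqr_ge0 //.
  have := sqr_ge0 (A * g x ^+ 2 - B * f x ^+ 2).
  have : (f x * g x) ^+ 2 * Z ^+ 2 <= (f x * g x) ^+ 2 * (A * B).
    by rewrite ler_wpM2l // sqr_ge0.
  move: (f x) (g x) => a b; rewrite !exprMn.
  move: (Z ^+ 2) => z; nra.
nra.
Qed.

Lemma sum_inv_sqr_le (M : nat) : \sum_(m < M) (m.+1%:R ^+ 2)^-1 <= 2 :> R.
Proof.
case: M => [|M]; first by rewrite big_ord0.
suff : \sum_(m < M.+1) (m.+1%:R ^+ 2)^-1 <= 2 - M.+1%:R^-1 :> R.
  by move=> /le_trans; apply; rewrite gerBl invr_ge0.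
elim: M => [|M IH]; first by rewrite big_ord1 expr1n invr1; lra.
rewrite big_ord_recr /=; apply: le_trans (lerD IH (lexx _)) _.
have p1 : 0 < M.+1%:R :> R by [].
rewrite -(natr1 M.+1); move: M.+1%:R p1 => x p1.
rewrite -subr_ge0.
have -> : 2 - (x + 1)^-1 - (2 - x^-1 + ((x + 1) ^+ 2)^-1) = (x * (x + 1) ^+ 2)^-1.
  by field; rewrite !gt_eqF //; lra.
by rewrite invr_ge0 mulr_ge0 ?sqr_ge0 // ltW.
Qed.

End FiniteSums.

Section Trigonometry.
Variable R : realType.

Lemma sin_natpi (k : nat) : sin (k%:R * pi) = 0 :> R.
Proof.
elim: k => [|k IH]; first by rewrite mul0r sin0.
by rewrite -natr1 mulrDl mul1r sinDpi IH oppr0.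
Qed.

Lemma cos_natpi (k : nat) : cos (k%:R * pi) = (-1) ^+ k :> R.
Proof.
elim: k => [|k IH]; first by rewrite mul0r cos0.
by rewrite -natr1 mulrDl mul1r cosDpi IH exprS mulN1r.
Qed.

(** Multiplying by 2 sin (m pi / (2 N)) makes the sum telescope; the hypothesis
on [m] keeps that factor nonzero. *)
Lemma sum_cos_nodes (N m : nat) : (0 < m < 2 * N)%N ->
  \sum_(j < N) cos (m%:R * pi * (j%:R / N%:R)) = (odd m)%:R :> R.
Proof.
move=> /andP[m0 mN].
have N0 : (0 < N)%N by lia.
have NR : N%:R != 0 :> R by rewrite pnatr_eq0; lia.
set y : R := m%:R * pi / (2 * N%:R).
have sy : 0 < sin y.
  apply: sin_gt0_pi; apply/andP; split.
    by rewrite /y divr_gt0 ?mulr_gt0 ?pi_gt0 ?ltr0n.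
  rewrite /y ltr_pdivrMr ?mulr_gt0 ?ltr0n // mulrC ltr_pM2l ?pi_gt0 //.
  by rewrite -natrM ltr_nat.
have tele (M : nat) : 2 * sin y * (\sum_(j < M) cos (m%:R * pi * (j%:R / N%:R)))
    = sin ((2 * M%:R - 1) * y) + sin y.
  elim: M => [|M IH].
    by rewrite big_ord0 mulr0 mulr0 sub0r mulN1r sinN addNr.
  rewrite big_ord_recr /= mulrDr IH.
  have -> : m%:R * pi * (M%:R / N%:R) = 2 * M%:R * y by rewrite /y; field.
  have -> : (2 * M.+1%:R - 1) * y = 2 * M%:R * y + y by rewrite -natr1; ring.
  have -> : (2 * M%:R - 1) * y = 2 * M%:R * y - y by ring.
  by rewrite sinB sinD; ring.
have := tele N.
have -> : (2 * N%:R - 1) * y = m%:R * pi - y by rewrite /y; field.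
rewrite sinB sin_natpi cos_natpi -signr_odd => e.
apply: (mulfI (x := 2 * sin y)); first by rewrite mulf_neq0 // gt_eqF.
by rewrite e; case: (odd m); rewrite /= ?expr1 ?expr0; ring.
Qed.

Lemma phi_mulE (k l : nat) (x : R) : (l <= k)%N ->
  phi k x * phi l x =
  cos ((k - l)%N%:R * pi * x) - cos ((k + l)%N%:R * pi * x).
Proof.
move=> lk; rewrite /phi natrB // natrD.
rewrite mulrACA -expr2 sqr_sqrtr //.
rewrite !mulrBl !mulrDl cosB cosD; ring.
Qed.

(** By [phi_mulE] the sum is a difference of two sums of cosines with
frequencies k - l and k + l, which have the same parity and so cancel by
[sum_cos_nodes] unless k = l.  The node 0 adds nothing, as the modes vanish
there. *)
Lemma sum_phi_nodes (N k l : nat) : (0 < k < N)%N -> (0 < l < N)%N ->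
  \sum_(j < N) phi k (j%:R / N%:R) * phi l (j%:R / N%:R) = N%:R *+ (k == l) :> R.
Proof.
wlog lk : k l / (l <= k)%N.
  move=> H hk hl; case: (leqP l k) => [/H|/ltnW lk]; first exact.
  by rewrite eq_sym -(H l k) //; apply: eq_bigr => j _; rewrite mulrC.
move=> /andP[k0 kN] /andP[l0 lN].
under eq_bigr => j _ do rewrite (phi_mulE _ lk).
rewrite big_split sumrN /= (sum_cos_nodes (m := (k + l)%N)); last lia.
case: eqVneq lk => [-> _|kl lk].
  rewrite subnn oddD addbb subr0.
  under eq_bigr => j _ do rewrite mul0r mul0r cos0.
  by rewrite sumr_const card_ord mulr1n.
rewrite (sum_cos_nodes (m := (k - l)%N)); last lia.
by rewrite oddB // oddD subrr.
Qed.

Lemma phi_at0 (k : nat) : phi k 0 = 0 :> R.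
Proof. by rewrite /phi mulr0 sin0 mulr0. Qed.

Lemma phi_index0 (x : R) : phi 0 x = 0 :> R.
Proof. by rewrite /phi !mul0r sin0 mulr0. Qed.

Lemma phi_node_end (N k : nat) : (0 < N)%N -> phi k (N%:R / N%:R) = 0 :> R.
Proof.
move=> N0; rewrite divff ?pnatr_eq0 -?lt0n // /phi mulr1.
by rewrite sin_natpi mulr0.
Qed.

Lemma sum_interior_nodes (n : nat) (F : nat -> R) : F 0 = 0 ->
  \sum_(i < n) F i.+1 = \sum_(j < n.+1) F j.
Proof. by move=> F0; rewrite big_ord_recl F0 add0r. Qed.

Lemma phi_abs_le (k : nat) (x : R) : `|phi k x| <= 2.
Proof.
rewrite /phi normrM ger0_norm ?sqrtr_ge0 //.
apply: le_trans (ler_wpM2l (sqrtr_ge0 _) (sin_max _)) _.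
rewrite mulr1 -(ler_pXn2r (n := 2)) ?nnegrE ?sqrtr_ge0 // sqr_sqrtr //; lra.
Qed.

End Trigonometry.

(** * Spectrum and resolvent of the finite difference matrix *)

Section DiscreteSpectrum.
Local Open Scope complex_scope.
Variable R : realType.

Definition fdmx_eig (N k : nat) : R :=
  4 * N%:R ^+ 2 * sin (k%:R * pi / (2 * N%:R)) ^+ 2.

Lemma sum_ord_eq (n k : nat) (F : nat -> R) :
  \sum_(j < n) (k == j :> nat)%:R * F j = (k < n)%:R * F k.
Proof.
case: ltnP => kn.
  rewrite (bigD1 (Ordinal kn)) //= eqxx big1 ?addr0 // => j /eqP jk.
  case: eqP => [e|_]; last by rewrite mul0r.
  by case: jk; apply: val_inj; rewrite /= e.
rewrite big1 ?mul0r // => j _; case: eqP => [e|_]; last by rewrite mul0r.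
by have := ltn_ord j; lia.
Qed.

(** The matrix acts as a three-term recurrence, even in its first and last
rows, on the interior values of a grid function that vanishes at both ends. *)
Lemma fdmx_mul (n : nat) (F : nat -> R) (i : 'I_n) : F 0%N = 0 -> F n.+1 = 0 ->
  \sum_(j < n) fdmx R n.+1 i j * F j.+1 =
  n.+1%:R ^+ 2 * (2 * F i.+1 - F i - F i.+2).
Proof.
move=> F0 Fn.
have fdE (j : 'I_n) : fdmx R n.+1 i j * F j.+1 = n.+1%:R ^+ 2 *
  (2 * ((i == j :> nat)%:R * F j.+1) - (i.+1 == j :> nat)%:R * F j.+1
    - (i == j.+1 :> nat)%:R * F j.+1).
  rewrite mxE -mulrA; congr (_ * _).
  case: (eqVneq (i : nat) j) => [->|ij].
    rewrite (gtn_eqF (ltnSn j)) (ltn_eqF (ltnSn j)) /=; ring.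
  rewrite [(i : nat) == j.+1]eq_sym.
  case: (eqVneq i.+1 (j : nat)) => [e|e].
    by rewrite (_ : (j.+1 == i) = false) /=; [rewrite mulr1n mulr0n; ring | lia].
  by case: (eqVneq j.+1 (i : nat)) => [_|_] /=; rewrite ?mulr1n ?mulr0n; ring.
under eq_bigr => j _ do rewrite fdE.
rewrite -mulr_sumr; congr (_ * _).
rewrite 2!big_split /= !sumrN -mulr_sumr.
rewrite (sum_ord_eq _ _ (fun j => F j.+1)) (sum_ord_eq _ _ (fun j => F j.+1)).
rewrite (ltn_ord i) mul1r.
have -> : (i.+1 < n)%:R * F i.+2 = F i.+2.
  case: ltnP => [_|ni]; first by rewrite mul1r.
  have -> : i.+2 = n.+1 by have := ltn_ord i; lia.
  by rewrite Fn mulr0.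
have -> : \sum_(j < n) (i == j.+1 :> nat)%:R * F j.+1 = F i.
  rewrite (sum_interior_nodes n (F := fun j => ((i : nat) == j)%:R * F j)); last first.
    by rewrite F0 mulr0.
  by rewrite sum_ord_eq (ltn_trans (ltn_ord i)) ?mul1r.
ring.
Qed.

Lemma fdmx_phi (n k : nat) (i : 'I_n) :
  \sum_(j < n) fdmx R n.+1 i j * phi k (j.+1%:R / n.+1%:R) =
  fdmx_eig n.+1 k * phi k (i.+1%:R / n.+1%:R).
Proof.
rewrite (fdmx_mul (F := fun j => phi k (j%:R / n.+1%:R))); first last.
- by rewrite phi_node_end.
- by rewrite mul0r phi_at0.
rewrite /fdmx_eig /phi.
set a := k%:R * pi * (i.+1%:R / n.+1%:R).
set b : R := k%:R * pi / (2 * n.+1%:R).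
have NR : n.+1%:R != 0 :> R by [].
have -> : k%:R * pi * (i%:R / n.+1%:R) = a - (b *+ 2).
  by rewrite /a /b -(natr1 i); field.
have -> : k%:R * pi * (i.+2%:R / n.+1%:R) = a + (b *+ 2).
  by rewrite /a /b -(natr1 i.+1); field.
rewrite (sinB a) (sinD a) cos_mulr2n (cos2sin2 b); ring.
Qed.

(** The symmetric matrix of the discrete sine transform. *)
Definition sinemx (n : nat) : 'M[R[i]]_n :=
  \matrix_(i, k) (phi k.+1 (i.+1%:R / n.+1%:R))%:C.

Lemma sinemx_sqr (n : nat) : sinemx n *m sinemx n = n.+1%:R%:M.
Proof.
apply/matrixP => i l; rewrite !mxE.
transitivity ((\sum_(j < n) (phi i.+1 (j.+1%:R / n.+1%:R) *
    phi l.+1 (j.+1%:R / n.+1%:R)))%:C : R[i]).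
  rewrite rmorph_sum; apply: eq_bigr => j _; rewrite !mxE [RHS]rmorphM.
  congr (_ * _); congr (_%:C); rewrite /phi; congr (_ * sin _); ring.
rewrite (sum_interior_nodes n (F := fun j => phi i.+1 (j%:R / n.+1%:R) *
    phi l.+1 (j%:R / n.+1%:R))); last by rewrite mul0r !phi_at0 mulr0.
rewrite sum_phi_nodes ?ltnS ?ltn_ord //.
by rewrite rmorphMn /= rmorph_nat.
Qed.

(** The sine transform is symmetric, its square is a multiple of the identity,
and it diagonalises the matrix; this yields an explicit inverse. *)
Lemma fdmx_resolvent (n : nat) (w : R[i]) (c : nat -> R) :
  (forall k, (k < n)%N -> w + (fdmx_eig n.+1 k.+1)%:C != 0) ->
  let A := map_mx (real_complex R) (fdmx R n.+1) in
  forall i : 'I_n,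
  (invmx (w%:M + A) *m map_mx (real_complex R)
     (\col_(i < n) \sum_(1 <= k < n.+1) c k * phi k (i.+1%:R / n.+1%:R))) i 0 =
  \sum_(1 <= k < n.+1)
    (w + (fdmx_eig n.+1 k)%:C)^-1 * (c k)%:C * (phi k (i.+1%:R / n.+1%:R))%:C.
Proof.
move=> w0 A.
set M := w%:M + A; set S := sinemx n.
pose d : 'rV[R[i]]_n := \row_k (w + (fdmx_eig n.+1 k.+1)%:C).
pose d' : 'rV[R[i]]_n := \row_k (w + (fdmx_eig n.+1 k.+1)%:C)^-1.
have MS : M *m S = S *m diag_mx d.
  rewrite mul_mx_diag /M mulmxDl mul_scalar_mx; apply/matrixP => i k.
  rewrite [LHS]mxE [X in X + _]mxE [X in _ + X]mxE [RHS]mxE [d _ _]mxE.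
  rewrite mulrDr [w * _]mulrC; congr (_ + _).
  rewrite [S i k]mxE -[RHS]rmorphM mulrC -fdmx_phi rmorph_sum.
  apply: eq_bigr => j _.
  by rewrite [A i j]mxE [S j k]mxE -[LHS]rmorphM.
have dd : diag_mx d *m diag_mx d' = 1%:M.
  rewrite mulmx_diag -diag_const_mx; congr diag_mx.
  by apply/rowP => k; rewrite !mxE divff // w0.
have SMS : M *m (S *m diag_mx d') = S by rewrite mulmxA MS -mulmxA dd mulmx1.
have N0 : n.+1%:R != 0 :> R[i] by rewrite pnatr_eq0.
have Mu : M \in unitmx.
  have /mulmx1_unit[] // : M *m (S *m diag_mx d' *m (n.+1%:R^-1 *: S)) = 1%:M.
  by rewrite mulmxA SMS -scalemxAr sinemx_sqr scale_scalar_mx mulVf.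
pose cv : 'cV[R[i]]_n := \col_k (c k.+1)%:C.
have -> : map_mx (real_complex R)
     (\col_(i < n) \sum_(1 <= k < n.+1) c k * phi k (i.+1%:R / n.+1%:R)) = S *m cv.
  apply/colP => i; rewrite !mxE big_add1 big_mkord rmorph_sum /=.
  by apply: eq_bigr => k _; rewrite !mxE rmorphM /= mulrC.
move=> i; rewrite -{1}SMS -mulmxA mulKmx // !mxE big_add1 big_mkord.
apply: eq_bigr => k _; rewrite mul_mx_diag !mxE mulrC; ring.
Qed.

(** Everything follows from sin y = y cos z with 0 < z < y, and from
cos z >= 1 - z^2 / 2.  The lower bound uses the half angle, so that the cosine
is evaluated below pi/4. *)
Lemma sin_bounds (y : R) : 0 < y <= pi / 2 ->
  y / 2 <= sin y /\ y ^+ 2 - sin y ^+ 2 <= y ^+ 4 /\ sin y <= y.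
Proof.
move=> /andP[y0 yp].
have sle (x : R) : 0 < x -> exists2 z, 0 < z < x & sin x = x * cos z.
  move=> x0.
  have [z zx] := @MVT R sin cos 0 x x0 (fun z _ => is_derive_sin z)
    (continuous_subspaceT (@continuous_sin R)).
  rewrite sin0 !subr0 mulrC => e; exists z => //.
have cge (x : R) : 0 < x -> 1 - x ^+ 2 / 2 <= cos x.
  move=> x0.
  have -> : cos x = 1 - 2 * sin (x / 2) ^+ 2.
    have -> : cos x = cos ((x / 2) *+ 2) by congr cos; rewrite -mulr_natr; field.
    by rewrite cos_mulr2n cos2sin2; ring.
  have [|z _ e] := sle (x / 2); first by lra.
  have : sin (x / 2) ^+ 2 <= (x / 2) ^+ 2.
    by rewrite e exprMn ler_piMr ?sqr_ge0 // -(cos2Dsin2 z) lerDl sqr_ge0.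
  move: (sin (x / 2)) => s sv; nra.
(* sin y = y cos z; then y^2 - sin^2 y = y^2 (1 - cos z) (1 + cos z). *)
have [z /andP[z0 zy] e] := sle _ y0.
have c1 := cos_le1 z.
have c2 := cge _ z0.
have c0 : 0 <= cos z by apply: cos_ge0_pihalf; lra.
split; last split.
- have [|v /andP[v0 vy] ev] := sle (y / 2); first lra.
  have cq : 1 / 2 <= cos (y / 2) ^+ 2.
    have : 0 <= cos y by apply: cos_ge0_pihalf; lra.
    have -> : cos y = cos ((y / 2) *+ 2) by congr cos; rewrite -mulr_natr; field.
    by rewrite cos_mulr2n -mulr_natr; lra.
  have cp : 0 <= cos (y / 2) by apply: cos_ge0_pihalf; lra.
  have cv : cos (y / 2) <= cos v.
    rewrite leNgt ltr_cos ?in_itv /=; [lra| |]; lra.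
  have -> : sin y = sin ((y / 2) *+ 2) by congr sin; rewrite -mulr_natr; field.
  rewrite sin_mulr2n ev.
  have : cos (y / 2) ^+ 2 <= cos (y / 2) * cos v by rewrite expr2 ler_wpM2l.
  move=> /(le_trans cq); move: (cos (y / 2)) (cos v) => p q pq.
  have : y * (1 / 2) <= y * (p * q) by rewrite ler_pM2l.
  by move=> h; rewrite -[leRHS]mulr_natr; lra.
- rewrite e; have zz : z ^+ 2 <= y ^+ 2 by nra.
  have : 1 - cos z <= y ^+ 2 / 2 by lra.
  have y2 : 0 <= y ^+ 2 by exact: sqr_ge0.
  have -> : y ^+ 2 - (y * cos z) ^+ 2 = y ^+ 2 * ((1 - cos z) * (1 + cos z)) by ring.
  have -> : y ^+ 4 = y ^+ 2 * y ^+ 2 by ring.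
  move=> h; rewrite ler_wpM2l //; nra.
- rewrite e; nra.
Qed.

Lemma lambda_gt0 (k : nat) : (0 < k)%N -> 0 < lambda R k.
Proof. by move=> k0; rewrite mulr_gt0 ?exprn_gt0 ?ltr0n ?pi_gt0. Qed.

Lemma lambda_ge_sqr (k : nat) : k%:R ^+ 2 <= lambda R k.
Proof.
rewrite /lambda ler_peMr ?sqr_ge0 // expr_ge1 ?pi_ge0 //.
by have := pi_ge2 R; lra.
Qed.

(** With y = k pi / (2 N) one has lambda_k = 4 N^2 y^2 and
mu_k = 4 N^2 sin^2 y, and [sin_bounds] applies since y <= pi/2. *)
Lemma fdmx_eig_bounds (N k : nat) : (0 < k < N)%N ->
  lambda R k / 4 <= fdmx_eig N k /\
  lambda R k - fdmx_eig N k <= lambda R k ^+ 2 / (4 * N%:R ^+ 2) /\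
  fdmx_eig N k <= lambda R k.
Proof.
move=> /andP[k0 kN].
have N0 : 0 < N%:R :> R by rewrite ltr0n; lia.
set y : R := k%:R * pi / (2 * N%:R).
have hy : 0 < y <= pi / 2.
  apply/andP; split; first by rewrite divr_gt0 ?mulr_gt0 ?pi_gt0 ?ltr0n // (ltn_trans k0).
  have -> : y = (k%:R / N%:R) * (pi / 2) by rewrite /y; field; rewrite gt_eqF.
  rewrite ler_piMl ?divr_ge0 ?pi_ge0 // ler_pdivrMr // mul1r ler_nat ltnW //.
have [b1 [b2 b3]] := sin_bounds hy.
have lamE : lambda R k = 4 * N%:R ^+ 2 * y ^+ 2.
  by rewrite /y /lambda; field; rewrite gt_eqF.
have -> : lambda R k ^+ 2 / (4 * N%:R ^+ 2) = 4 * N%:R ^+ 2 * y ^+ 4.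
  by rewrite lamE; field; rewrite gt_eqF.
rewrite lamE /fdmx_eig -/y.
have N4 : 0 <= 4 * N%:R ^+ 2 :> R by rewrite mulr_ge0 ?sqr_ge0.
case/andP: hy => y0 _.
split; last split.
- rewrite -mulrA ler_wpM2l //; nra.
- by rewrite -mulrBr ler_wpM2l.
- rewrite ler_wpM2l //; nra.
Qed.

Lemma fdmx_eig_gt0 (N k : nat) : (0 < k < N)%N -> 0 < fdmx_eig N k.
Proof.
move=> kN; have [h _] := fdmx_eig_bounds kN; apply: lt_le_trans h.
by rewrite divr_gt0 // lambda_gt0 //; case/andP: kN.
Qed.

End DiscreteSpectrum.

(** * Power sums behind the maximum-norm rate *)

Section PowerSums.
Variable R : realType.

(** Discrete comparison with an antiderivative. *)
Lemma ler_sum_telescope (f F : nat -> R) (m n : nat) : (m <= n)%N ->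
  (forall k, (m <= k < n)%N -> f k <= F k.+1 - F k) ->
  \sum_(m <= k < n) f k <= F n - F m.
Proof.
move=> mn fF; rewrite -telescope_sumr //.
rewrite big_nat_cond [leRHS]big_nat_cond.
by apply: ler_sum => k /andP[/fF].
Qed.

Lemma gt0_powRB (x r s : R) : 0 < x -> x `^ (r - s) = x `^ r / x `^ s.
Proof. by move=> x0; rewrite powRB // (gt_eqF x0) implybT. Qed.

Lemma powR_natE (k : nat) (x : R) : (0 < k)%N -> k%:R `^ x = expR (x * ln k%:R).
Proof. by move=> k0; rewrite /powR pnatr_eq0 gtn_eqF. Qed.

(** All power sums below are compared with telescoping sums of powers, or
logarithms, of k; this bound on ln (k+1) - ln k is the only estimate needed, as
e^y >= 1 + y transfers it to powers. *)
Lemma ln_succ_ge (k : nat) : (0 < k)%N ->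
  (2 * k%:R)^-1 <= ln k.+1%:R - ln k%:R :> R.
Proof.
move=> k0; have kR : 0 < k%:R :> R by rewrite ltr0n.
have k1 : 1 <= k%:R :> R by rewrite ler1n.
have kS : 0 < k.+1%:R :> R by [].
have -> : ln k.+1%:R - ln k%:R = - ln (1 + - k.+1%:R^-1) :> R.
  rewrite (_ : 1 + - k.+1%:R^-1 = k%:R / k.+1%:R).
    by rewrite ln_div ?posrE // opprB.
  by rewrite -(natr1 k); field; rewrite natr1.
have h : -1 < - k.+1%:R^-1 :> R.
  by rewrite ltrN2 invf_lt1 // ltr1n.
have := le_ln1Dx h.
rewrite -lerN2 opprK => /(le_trans _); apply.
by rewrite lef_pV2 ?posrE ?mulr_gt0 // -natr1; lra.
Qed.

Lemma sum_powR_growing (s : R) (N : nat) : 0 < s -> (0 < N)%N ->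
  \sum_(1 <= k < N) k%:R `^ (s - 1) <= 2 / s * N%:R `^ s.
Proof.
move=> s0 N0.
have step (k : nat) : (1 <= k < N)%N ->
    k%:R `^ (s - 1) <= 2 / s * k.+1%:R `^ s - 2 / s * k%:R `^ s.
  move=> /andP[k0 _]; have kR : 0 < k%:R :> R by rewrite ltr0n.
  have -> : k%:R `^ (s - 1) = 2 / s * (k%:R `^ s * (s * (2 * k%:R)^-1)).
    rewrite gt0_powRB // powRr1 ?[0 <= _]ltW //.
    by field; rewrite !gt_eqF.
  rewrite -mulrBr ler_wpM2l ?divr_ge0 ?[0 <= _]ltW //.
  have -> : k.+1%:R `^ s = k%:R `^ s * expR (s * (ln k.+1%:R - ln k%:R)).
    by rewrite !powR_natE // -expRD; congr expR; ring.
  rewrite -[X in _ - X]mulr1 -mulrBr ler_wpM2l ?powR_ge0 //.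
  rewrite lerBrDr addrC; apply: le_trans (expR_ge1Dx _).
  by rewrite lerD2l ler_wpM2l ?[0 <= _]ltW // ln_succ_ge.
apply: le_trans (ler_sum_telescope (F := fun k => 2 / s * k%:R `^ s) N0 step) _.
by rewrite gerBl mulr_ge0 ?powR_ge0 // divr_ge0 ?[0 <= _]ltW.
Qed.

Lemma sum_inv_le_ln (N : nat) : (0 < N)%N ->
  \sum_(1 <= k < N) (k%:R)^-1 <= 2 * ln N%:R :> R.
Proof.
move=> N0.
have step (k : nat) : (1 <= k < N)%N ->
    (k%:R)^-1 <= 2 * ln k.+1%:R - 2 * ln k%:R :> R.
  move=> /andP[k0 _]; have := ln_succ_ge k0.
  by rewrite invfM; lra.
apply: le_trans (ler_sum_telescope (F := fun k => 2 * ln k%:R) N0 step) _.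
by rewrite ln1 mulr0 subr0.
Qed.

Lemma sum_powR_bounded (s : R) (N : nat) : 0 < s -> (0 < N)%N ->
  \sum_(1 <= k < N) k%:R `^ (- s - 1) <= (2 + s) / s.
Proof.
move=> s0 N0; pose c := (2 + s) / s.
have c0 : 0 < c by rewrite divr_gt0 // addr_gt0.
have step (k : nat) : (1 <= k < N)%N ->
    k%:R `^ (- s - 1) <= (- c * k.+1%:R `^ (- s)) - (- c * k%:R `^ (- s)).
  move=> /andP[k0 _]; have kR : 0 < k%:R :> R by rewrite ltr0n.
  have k1 : 1 <= k%:R :> R by rewrite ler1n.
  have -> : k.+1%:R `^ (- s) = k%:R `^ (- s) * expR (- (s * (ln k.+1%:R - ln k%:R))).
    by rewrite !powR_natE // -expRD; congr expR; ring.
  rewrite gt0_powRB // powRr1 ?[0 <= _]ltW //.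
  have -> (x e : R) : - c * (x * e) - (- c * x) = x * (c * (1 - e)) by ring.
  rewrite ler_wpM2l ?powR_ge0 //.
  set y := s * (ln _ - _).
  have hy : s / (2 * k%:R) <= y by rewrite ler_wpM2l ?[0 <= _]ltW // ln_succ_ge.
  have y0 : 0 < s / (2 * k%:R) by rewrite divr_gt0 ?mulr_gt0.
  have e1 : expR (- y) <= (1 + s / (2 * k%:R))^-1.
    rewrite expRN lef_pV2 ?posrE ?expR_gt0 ?addr_gt0 //.
    by apply: le_trans (expR_ge1Dx y); rewrite lerD2l.
  have : c * (1 - (1 + s / (2 * k%:R))^-1) <= c * (1 - expR (- y)).
    by rewrite ler_wpM2l ?[0 <= _]ltW // lerD2l lerN2.
  apply: le_trans.
  have -> : c * (1 - (1 + s / (2 * k%:R))^-1) = (2 + s) / (2 * k%:R + s).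
    by rewrite /c; field; rewrite !gt_eqF // ?addr_gt0 ?mulr_gt0.
  rewrite ler_pdivlMr ?addr_gt0 ?mulr_gt0 // mulrDr (mulrCA _ 2) mulVf ?gt_eqF //.
  by rewrite mulr1 lerD2l ler_piMl ?[0 <= _]ltW // invf_le1.
apply: le_trans (ler_sum_telescope (F := fun k => - c * k%:R `^ (- s)) N0 step) _.
rewrite powR1; have : 0 <= c * N%:R `^ (- s) by rewrite mulr_ge0 ?powR_ge0 ?[0 <= _]ltW.
by rewrite -/c; lra.
Qed.

Lemma sum_inv_sqr_tail (N n : nat) : (0 < N)%N -> (N <= n)%N ->
  \sum_(N <= k < n) (k%:R ^+ 2)^-1 <= 2 / N%:R :> R.
Proof.
move=> N0 Nn.
have step (k : nat) : (N <= k < n)%N ->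
    (k%:R ^+ 2)^-1 <= - 2 / k.+1%:R - (- 2 / k%:R) :> R.
  move=> /andP[Nk _].
  have k1 : 1 <= k%:R :> R by rewrite ler1n; lia.
  have kS : 0 < k.+1%:R :> R by [].
  have -> : - 2 / k.+1%:R - (- 2 / k%:R) = 2 / (k%:R * k.+1%:R) :> R.
    rewrite -(natr1 k); field; rewrite natr1 !gt_eqF //; lra.
  rewrite -[leRHS]invrK invf_div lef_pV2 ?posrE ?divr_gt0 ?mulr_gt0 ?exprn_gt0 //; try lra.
  rewrite ler_pdivrMr // -natr1; nra.
apply: le_trans (ler_sum_telescope (F := fun k => - 2 / k%:R) Nn step) _.
by rewrite !mulNr opprK gerDr oppr_le0 divr_ge0.
Qed.

End PowerSums.

Section ModeSums.
Variable R : realType.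

(** What Cauchy-Schwarz leaves of the bound max(k, N)^-2 on the k-th
coefficient, once k^(2 sigma) is given to the square of c_k. *)
Definition mode_weight (sigma : R) (N k : nat) : R :=
  k%:R `^ (- (2 * sigma)) / (maxn k N)%:R ^+ 4.

Definition linf_rate (sigma : R) (N : nat) : R :=
  (N%:R^-1) `^ (Num.min (sigma + 3 / 2) 2)
     * ell (N%:R^-1) `^ (chi0 (1 / 4 - sigma / 2)).

Lemma sum_mode_weight_tail (sigma : R) (N n : nat) : 0 <= sigma -> (0 < N)%N -> (N <= n)%N ->
  \sum_(N <= k < n) mode_weight sigma N k <= 2 * N%:R `^ (- (2 * sigma) - 3).
Proof.
move=> s0 N0 Nn; have NR : 0 < N%:R :> R by rewrite ltr0n.
have -> : 2 * N%:R `^ (- (2 * sigma) - 3) =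
    N%:R `^ (- (2 * sigma)) * (N%:R ^+ 2)^-1 * (2 / N%:R) :> R.
  rewrite gt0_powRB // powR_mulrn ?[0 <= _]ltW //.
  by field; rewrite gt_eqF.
apply: (@le_trans _ _ (N%:R `^ (- (2 * sigma)) * (N%:R ^+ 2)^-1 *
    \sum_(N <= k < n) (k%:R ^+ 2)^-1)); last first.
  by rewrite ler_wpM2l ?sum_inv_sqr_tail // mulr_ge0 ?powR_ge0 // invr_ge0 sqr_ge0.
rewrite mulr_sumr big_nat_cond [leRHS]big_nat_cond.
apply: ler_sum => k /andP[/andP[Nk _] _].
have kR : 0 < k%:R :> R by rewrite ltr0n; lia.
rewrite /mode_weight (maxn_idPl Nk) -mulrA ler_pM ?powR_ge0 //.
- rewrite !powRN lef_pV2 ?posrE ?powR_gt0 //.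
  by apply: ge0_ler_powR; rewrite ?mulr_ge0 // ?ler_nat // nnegrE ler0n.
- rewrite -invfM lef_pV2 ?posrE ?mulr_gt0 ?exprn_gt0 //.
  rewrite (_ : 4 = 2 + 2)%N // exprD ler_pM2r ?exprn_gt0 //.
  by rewrite ler_pXn2r ?nnegrE ?[0 <= _]ltW // ler_nat.
Qed.

Lemma mode_weight_ge0 (sigma : R) (N k : nat) : 0 <= mode_weight sigma N k.
Proof. by rewrite divr_ge0 ?powR_ge0 ?exprn_ge0. Qed.

(** The modes k >= N contribute N^(-3-2 sigma) in all cases.  The modes
k < N contribute N^-4 times the sum of k^(-2 sigma), which grows like
N^(1-2 sigma), grows like ln N or stays bounded.  For N = 1 the claim fails at
sigma = 1/2, where the rate is zero. *)
Lemma sum_mode_weight_le (sigma : R) : 0 <= sigma -> exists2 C : R, 0 < C &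
  forall N n : nat, (1 < N)%N ->
  \sum_(1 <= k < n) mode_weight sigma N k <= C * linf_rate sigma N ^+ 2.
Proof.
move=> s0.
have split_sum (N n : nat) : (1 < N)%N ->
  \sum_(1 <= k < n) mode_weight sigma N k <=
  (\sum_(1 <= k < N) k%:R `^ (- (2 * sigma))) / N%:R ^+ 4 +
   2 * N%:R `^ (- (2 * sigma) - 3).
  move=> N1; apply: (@le_trans _ _ (\sum_(1 <= k < maxn n N) mode_weight sigma N k)).
    case: n => [|n]; first by rewrite big_geq // sumr_ge0 // => k _; exact: mode_weight_ge0.
    rewrite [leRHS](big_cat_nat _ (n := n.+1)) ?leq_maxl //= lerDl.
    by apply: sumr_ge0 => k _; exact: mode_weight_ge0.
  rewrite (big_cat_nat _ (n := N)) ?leq_maxr //=; last exact: ltnW.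
  rewrite lerD ?sum_mode_weight_tail ?leq_maxr //; try exact: ltnW.
  rewrite mulr_suml big_nat_cond [leRHS]big_nat_cond; apply: ler_sum.
  by move=> k /andP[/andP[_ kN] _]; rewrite /mode_weight (maxn_idPr _) // ltnW.
have NposR (N : nat) : (1 < N)%N -> 0 < N%:R :> R by move=> N1; rewrite ltr0n; lia.
have hE (N : nat) (x : R) : (1 < N)%N -> ((N%:R^-1) `^ x) ^+ 2 = N%:R `^ (- (2 * x)).
  move=> /NposR N0.
  by rewrite -powR_inv1 ?[0 <= _]ltW // -powRrM -powR_mulrn ?powR_ge0 // -powRrM; congr powR; ring.
have [slt|sgt|se] := ltgtP sigma (1 / 2).
- have t0 : 0 < 1 - 2 * sigma by lra.
  exists (2 / (1 - 2 * sigma) + 2); first by rewrite addr_gt0 // divr_gt0.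
  move=> N n N1; apply: le_trans (split_sum _ n N1) _.
  have N0 := NposR _ N1.
  rewrite /linf_rate /chi0 ifF; last by apply/negbTE; lra.
  rewrite powRr0 mulr1 min_l ?hE //; last lra.
  rewrite [leRHS]mulrDl lerD //; last first.
    rewrite ler_wpM2l // le_eqVlt; apply/orP; left; apply/eqP; congr powR; lra.
  have -> : N%:R `^ (- (2 * (sigma + 3 / 2))) = N%:R `^ (1 - 2 * sigma) / N%:R ^+ 4.
    rewrite -(powR_mulrn 4) ?[0 <= _]ltW // -gt0_powRB //.
    by congr powR; lra.
  rewrite mulrA ler_wpM2r ?invr_ge0 ?exprn_ge0 ?[0 <= _]ltW //.
  have := @sum_powR_growing R (1 - 2 * sigma) N t0 (ltnW N1).
  by have -> : 1 - 2 * sigma - 1 = - (2 * sigma) by ring.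
- have t0 : 0 < 2 * sigma - 1 by lra.
  exists ((2 + (2 * sigma - 1)) / (2 * sigma - 1) + 2).
    by rewrite addr_gt0 // divr_gt0 // addr_gt0.
  move=> N n N1; apply: le_trans (split_sum _ n N1) _.
  have N0 := NposR _ N1.
  rewrite /linf_rate /chi0 ifF; last by apply/negbTE; lra.
  rewrite powRr0 mulr1 min_r ?hE //; last lra.
  have e4 : N%:R `^ (- (2 * 2)) = (N%:R ^+ 4)^-1 :> R.
    by rewrite powRN -(powR_mulrn 4) ?[0 <= _]ltW //; congr (_ `^ _)^-1; ring.
  rewrite [leRHS]mulrDl lerD //.
    rewrite e4 ler_wpM2r ?invr_ge0 ?exprn_ge0 ?[0 <= _]ltW //.
    have := @sum_powR_bounded R (2 * sigma - 1) N t0 (ltnW N1).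
    by have -> : - (2 * sigma - 1) - 1 = - (2 * sigma) by ring.
  rewrite ler_wpM2l // ler_powR //; last by lra.
  by rewrite ler1n; lia.
- exists 8; first by [].
  move=> N n N1; apply: le_trans (split_sum _ n N1) _.
  have N0 := NposR _ N1.
  have -> : 2 * sigma = 1 by rewrite se; field.
  rewrite /linf_rate /chi0 ifT; last by apply/eqP; lra.
  rewrite exprMn min_r ?hE //; last lra.
  (* For N >= 2 the logarithm also absorbs the contribution of k >= N. *)
  have l2 : 1 <= 2 * ln N%:R :> R.
    have := @ln_succ_ge R 1 isT; rewrite ln1 subr0 mulr1.
    have : ln 2 <= ln N%:R :> R by rewrite ler_ln ?posrE // (ler_nat _ 2).
    lra.
  have -> : (ell N%:R^-1 `^ 1) ^+ 2 = ln N%:R :> R.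
    rewrite powRr1 ?powR_ge0 // /ell -powR_mulrn ?powR_ge0 // -powRrM.
    rewrite lnV ?posrE // normrN ger0_norm; last by lra.
    rewrite (_ : 1 / 2 * 2%:R = 1); last by field.
    by rewrite powRr1 //; lra.
  have e4 : N%:R `^ (- (2 * 2)) = (N%:R ^+ 4)^-1 :> R.
    by rewrite powRN -(powR_mulrn 4) ?[0 <= _]ltW //; congr (_ `^ _)^-1; ring.
  rewrite (_ : - 1 - 3 = - (2 * 2)); last by ring.
  rewrite e4 (mulrC _ (ln _)) mulrA -mulrDl.
  rewrite ler_wpM2r ?invr_ge0 ?exprn_ge0 ?[0 <= _]ltW //.
  have := @sum_inv_le_ln R N (ltnW N1).
  have -> : \sum_(1 <= k < N) k%:R `^ (-1) = \sum_(1 <= k < N) k%:R^-1 :> R.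
    by apply: eq_bigr => k _; rewrite powR_inv1.
  lra.
Qed.

End ModeSums.

(** * Sums of sine modes at the grid points *)

Section NodeSums.
Variable R : realType.
Implicit Types (a c : nat -> R) (K : R).

Lemma sum_blocks (N M : nat) (F : nat -> R) :
  \sum_(k < M * N) F k = \sum_(m < M) \sum_(l < N) F (m * N + l)%N.
Proof.
elim: M => [|M IH]; first by rewrite !big_ord0.
by rewrite mulSnr big_split_ord /= IH big_ord_recr.
Qed.

(** Aliasing: on the grid, a shift of the frequency by a multiple of N only
multiplies by a sign that is common to the whole block of frequencies. *)
Lemma phi_alias (N m l j : nat) : (0 < N)%N ->
  phi (m * N + l) (j%:R / N%:R) = (-1) ^+ (m * j) * phi l (j%:R / N%:R) :> R.
Proof.
move=> N0; have NR : N%:R != 0 :> R by rewrite pnatr_eq0 -lt0n.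
rewrite /phi.
have -> : (m * N + l)%:R * pi * (j%:R / N%:R) =
    (m * j)%:R * pi + l%:R * pi * (j%:R / N%:R) :> R.
  by rewrite natrD !natrM; field.
by rewrite sinD sin_natpi cos_natpi mul0r add0r mulrCA.
Qed.

(** Within a block the common sign of [phi_alias] disappears in the square, and
discrete orthogonality applies.  It is an inequality because the first mode of
the block vanishes on the grid. *)
Lemma sum_sqr_block (N m : nat) (b : nat -> R) : (0 < N)%N ->
  \sum_(j < N) (\sum_(l < N) b l * phi (m * N + l) (j%:R / N%:R)) ^+ 2 <=
  N%:R * \sum_(l < N) b l ^+ 2.
Proof.
move=> N0.
have -> : \sum_(j < N) (\sum_(l < N) b l * phi (m * N + l) (j%:R / N%:R)) ^+ 2 =
    \sum_(j < N) \sum_(l < N) \sum_(k < N) b l * b k *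
      (phi l (j%:R / N%:R) * phi k (j%:R / N%:R)).
  apply: eq_bigr => j _.
  have -> : \sum_(l < N) b l * phi (m * N + l) (j%:R / N%:R) =
      (-1) ^+ (m * j) * \sum_(l < N) b l * phi l (j%:R / N%:R).
    by rewrite mulr_sumr; apply: eq_bigr => l _; rewrite phi_alias //; ring.
  rewrite exprMn sqrr_sign mul1r expr2 mulr_suml; apply: eq_bigr => l _.
  by rewrite mulr_sumr; apply: eq_bigr => k _; rewrite mulrACA.
rewrite exchange_big mulr_sumr; apply: ler_sum => l _.
rewrite exchange_big /=.
have orth (k : 'I_N) :
    \sum_(j < N) b l * b k * (phi l (j%:R / N%:R) * phi k (j%:R / N%:R)) =
    b l * b k * (N%:R *+ ((l == k) && (0 < l)%N)).
  rewrite -mulr_sumr; case: (posnP l) => [l0|l0].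
    by rewrite l0 andbF mulr0n big1 // => j _; rewrite phi_index0 mul0r.
  case: (posnP k) => [k0|k0].
    rewrite k0 big1; last by move=> j _; rewrite phi_index0 mulr0.
    by case: eqP => // e; move: l0; rewrite e k0.
  by rewrite sum_phi_nodes ?l0 ?k0 ?ltn_ord // andbT.
rewrite (bigD1 l) //= [X in _ + X]big1; last first.
  by move=> k kl; rewrite orth eq_sym (negbTE kl) mulr0.
rewrite addr0 orth eqxx expr2 mulrC ler_wpM2r //; first by rewrite -expr2 sqr_ge0.
by case: (0 < l)%N.
Qed.

(** Since max(k, N) is at least N and at least N (m+1) / 2 in block m, the
coefficients of that block are at most 2 K / (N^2 (m+1)).  Cauchy-Schwarz over
the blocks with the weights 1 / (m+1)^2, whose sum is at most 2, costs exactly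
the factor (m+1)^2 that this leaves in the squares. *)
Lemma node_sum_l2 a c K S (N M : nat) : (0 < N)%N ->
  (forall k, `|a k| * (maxn k N)%:R ^+ 2 <= K) ->
  \sum_(k < M * N) c k ^+ 2 <= S ->
  \sum_(j < N) (\sum_(k < M * N) a k * c k * phi k (j%:R / N%:R)) ^+ 2
  <= 8 * N%:R * (K / N%:R ^+ 2) ^+ 2 * S.
Proof.
move=> N0 aK cS.
have NR : 0 < N%:R :> R by rewrite ltr0n.
pose V m j : R := \sum_(l < N) a (m * N + l)%N * c (m * N + l)%N *
  phi (m * N + l) (j%:R / N%:R).
have K0 : 0 <= K by apply: le_trans (aK 0%N); rewrite mulr_ge0 ?sqr_ge0.
have key m l : (l < N)%N -> (m.+1%:R * a (m * N + l)%N) ^+ 2 <= 4 * (K / N%:R ^+ 2) ^+ 2.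
  move=> lN; set k := (m * N + l)%N.
  set x : R := (maxn k N)%:R.
  have xN : N%:R <= x by rewrite ler_nat leq_maxr.
  have x0 : 0 < x by apply: lt_le_trans xN.
  have mx : m.+1%:R * N%:R <= 2 * x.
    rewrite -natrM -natrM ler_nat mulSn mul2n -addnn leq_add ?leq_maxr //.
    by rewrite (leq_trans _ (leq_maxl _ _)) // leq_addr.
  have h1 : `|a k| <= K / x ^+ 2 by rewrite ler_pdivlMr ?exprn_gt0 // aK.
  have h : m.+1%:R * `|a k| <= 2 * (K / N%:R ^+ 2).
    apply: (@le_trans _ _ (m.+1%:R * (K / x ^+ 2))); first by rewrite ler_wpM2l.
    rewrite mulrCA (mulrCA 2) ler_wpM2l //.
    rewrite ler_pdivrMr ?exprn_gt0 // mulrAC ler_pdivlMr ?exprn_gt0 //.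
    have : m.+1%:R * N%:R * N%:R <= 2 * x * x by apply: ler_pM; rewrite ?mulr_ge0.
    by rewrite !expr2 !mulrA.
  have -> : 4 * (K / N%:R ^+ 2) ^+ 2 = (2 * (K / N%:R ^+ 2)) ^+ 2.
    by rewrite [RHS]exprMn; congr (_ * _); ring.
  rewrite -(ger0_norm (sqr_ge0 _)) normrX ler_pXn2r ?nnegrE //.
    by rewrite normrM (ger0_norm (ler0n _ _)).
  by rewrite mulr_ge0 // divr_ge0 ?sqr_ge0.
have -> : \sum_(j < N) (\sum_(k < M * N) a k * c k * phi k (j%:R / N%:R)) ^+ 2 =
    \sum_(j < N) (\sum_(m < M) m.+1%:R^-1 * (m.+1%:R * V m j)) ^+ 2.
  apply: eq_bigr => j _; congr (_ ^+ 2).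
  rewrite (sum_blocks N M (fun k => a k * c k * phi k (j%:R / N%:R))).
  by apply: eq_bigr => m _; rewrite mulKf // pnatr_eq0.
apply: (@le_trans _ _ (\sum_(j < N) 2 * \sum_(m < M) (m.+1%:R * V m j) ^+ 2)).
  apply: ler_sum => j _; apply: le_trans (sqr_sum_le _ _ _ _) _.
  rewrite ler_wpM2r ?sumr_ge0 // => [m _|]; first exact: sqr_ge0.
  by under eq_bigr => m _ do rewrite exprVn; exact: sum_inv_sqr_le.
rewrite -mulr_sumr exchange_big /=.
apply: (@le_trans _ _ (2 * \sum_(m < M) N%:R * (4 * (K / N%:R ^+ 2) ^+ 2 *
    \sum_(l < N) c (m * N + l)%N ^+ 2))).
  rewrite ler_wpM2l //; apply: ler_sum => m _.
  have -> : \sum_(j < N) (m.+1%:R * V m j) ^+ 2 = \sum_(j < N) (\sum_(l < N)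
      (m.+1%:R * a (m * N + l)%N * c (m * N + l)%N) * phi (m * N + l) (j%:R / N%:R)) ^+ 2.
    apply: eq_bigr => j _; congr (_ ^+ 2); rewrite /V mulr_sumr.
    by apply: eq_bigr => l _; rewrite !mulrA.
  apply: le_trans (sum_sqr_block _ (fun l => m.+1%:R * a (m * N + l)%N * c (m * N + l)%N) N0) _.
  rewrite ler_wpM2l // mulr_sumr; apply: ler_sum => l _.
  by rewrite exprMn ler_wpM2r ?sqr_ge0 // key.
rewrite -mulr_sumr -mulr_sumr -(sum_blocks N M (fun k => c k ^+ 2)).
have -> (x y z : R) : 2 * (x * (4 * y * z)) = 8 * x * y * z by ring.
by rewrite ler_wpM2l // mulr_ge0 ?sqr_ge0 // mulr_ge0.
Qed.

(** Cauchy-Schwarz with the weight k^sigma; absolute values are kept so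
that the bound also gives the convergence of the infinite sum. *)
Lemma node_sum_linf a c K S (sigma : R) (N n : nat) (x : R) : 0 <= sigma ->
  (forall k, (0 < k)%N -> `|a k| * (maxn k N)%:R ^+ 2 <= K) ->
  \sum_(1 <= k < n) lambda R k `^ sigma * c k ^+ 2 <= S ->
  (\sum_(1 <= k < n) `|a k * c k * phi k x|) ^+ 2
  <= 4 * K ^+ 2 * (\sum_(1 <= k < n) mode_weight sigma N k) * S.
Proof.
move=> s0 aK cS.
pose f k : R := 2 * K * (k%:R `^ (- sigma) / (maxn k N)%:R ^+ 2).
pose g k : R := k%:R `^ sigma * `|c k|.
apply: (@le_trans _ _ ((\sum_(1 <= k < n) f k * g k) ^+ 2)).
  have le1 : \sum_(1 <= k < n) `|a k * c k * phi k x| <= \sum_(1 <= k < n) f k * g k.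
    rewrite big_nat_cond [leRHS]big_nat_cond; apply: ler_sum => k /andP[/andP[k0 _] _].
    have kR : 0 < k%:R :> R by rewrite ltr0n.
    have mR : 0 < (maxn k N)%:R :> R by rewrite ltr0n leq_max k0.
    have -> : f k * g k = K / (maxn k N)%:R ^+ 2 * `|c k| * 2.
      rewrite /f /g powRN.
      have /gt_eqF/negbT p := powR_gt0 sigma kR.
      by field; rewrite p (gt_eqF mR).
    rewrite normrM (normrM (a k)) ler_pM ?phi_abs_le // ?mulr_ge0 //.
    by rewrite ler_wpM2r // ler_pdivlMr ?exprn_gt0 // aK.
  have ge0 : 0 <= \sum_(1 <= k < n) `|a k * c k * phi k x| by exact: sumr_ge0.
  by rewrite ler_pXn2r ?nnegrE //; apply: le_trans le1.
apply: le_trans (sqr_sum_le _ _ _ _) _.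
apply: ler_pM; try by apply: sumr_ge0 => k _; exact: sqr_ge0.
  rewrite mulr_sumr big_nat_cond [leRHS]big_nat_cond; apply: ler_sum => k /andP[/andP[k0 _] _].
  rewrite /f /mode_weight le_eqVlt; apply/orP; left; apply/eqP.
  have -> : k%:R `^ (- (2 * sigma)) = (k%:R `^ (- sigma)) ^+ 2 :> R.
    by rewrite -powR_mulrn ?powR_ge0 // -powRrM; congr powR; ring.
  have : (maxn k N)%:R != 0 :> R by rewrite pnatr_eq0 -lt0n leq_max k0.
  by move=> mR; field.
apply: le_trans cS.
rewrite big_nat_cond [leRHS]big_nat_cond; apply: ler_sum => k /andP[/andP[k0 _] _].
rewrite /g exprMn real_normK ?num_real // ler_wpM2r ?sqr_ge0 //.
rewrite -powR_mulrn ?powR_ge0 // -powRrM mulrC powRrM.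
apply: ge0_ler_powR; rewrite // ?nnegrE ?powR_ge0 //.
  by rewrite ltW // lambda_gt0.
by rewrite powR_mulrn // lambda_ge_sqr.
Qed.

End NodeSums.

(** * Integrals along a ray *)

Section KernelIntegral.
Variable R : realType.
Local Notation mu := (@lebesgue_measure R).

(** The modulus of e^(zt) z^(alpha-1) at the point of modulus r of the contour,
for rho = - t cos theta. *)
Definition expkernel (rho alpha r : R) : R := expR (- (rho * r)) * r `^ (alpha - 1).

(** The function (r / (1 + t r))^alpha, written with exp and ln so that it can
be differentiated.  It increases from 0 to t^-alpha, and its derivative
dominates [expkernel] up to a constant: one antiderivative that handles the singularity at 0 and
the decay at infinity together. *)
Definition saturated_pow (alpha t r : R) : R := expR (alpha * (ln r - ln (1 + t * r))).

Lemma is_derive_saturated_pow (alpha t r : R) : 0 < t -> 0 < r ->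
  is_derive r 1 (saturated_pow alpha t) (saturated_pow alpha t r * (alpha / (r * (1 + t * r)))).
Proof.
move=> t0 r0; have q0 : 0 < 1 + t * r by rewrite addr_gt0 // mulr_gt0.
have d1 : is_derive r 1 (fun r => 1 + t * r) t.
  by apply: is_derive_eq; rewrite add0r mul1r /GRing.scale /= mulr1.
have d2 : is_derive r 1 (fun r => ln (1 + t * r)) ((1 + t * r)^-1 * t).
  exact (@is_derive1_comp R (@ln R) (fun r => 1 + t * r) r _ _ (is_derive1_ln q0) d1).
have d3 : is_derive r 1 (fun r => alpha * (ln r - ln (1 + t * r)))
    (alpha * (r^-1 - (1 + t * r)^-1 * t)).
  by have d0 := is_derive1_ln r0; apply: is_derive_eq.
apply: (is_derive_eq (@is_derive1_comp R expR _ r _ _ (is_derive_expR _) d3)).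
by rewrite /saturated_pow; congr (_ * _); field; rewrite !gt_eqF.
Qed.

Lemma saturated_pow_le (alpha t r : R) : 0 < alpha -> 0 < t -> 0 < r ->
  saturated_pow alpha t r <= t `^ (- alpha).
Proof.
move=> a0 t0 r0; have q0 : 0 < 1 + t * r by rewrite addr_gt0 // mulr_gt0.
rewrite /saturated_pow /powR gt_eqF // ler_expR mulNr -mulrN ler_pM2l //.
rewrite lerBlDr addrC -lnV ?posrE // -lnM ?posrE ?invr_gt0 //.
by rewrite ler_ln ?posrE ?mulr_gt0 ?invr_gt0 // mulrDl mul1r mulrAC mulfV ?gt_eqF //
  mul1r lerDr invr_ge0 ltW.
Qed.

(** The integrand may be unbounded at 0 and the interval is
unbounded, so the fundamental theorem of calculus is applied on the intervals
[1/(n+2), n+2], which exhaust the half-line. *)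
Lemma saturated_pow_integral_le (alpha t : R) : 0 < alpha -> 0 < t ->
  (\int[mu]_(r in `]0%R, +oo[)
     (saturated_pow alpha t r * (alpha / (r * (1 + t * r))))%:E <= (t `^ (- alpha))%:E)%E.
Proof.
move=> a0 t0; set f := fun r => saturated_pow alpha t r * (alpha / (r * (1 + t * r))).
pose I (n : nat) : set R := `[(n.+2%:R)^-1, n.+2%:R]%classic.
have n2 (n : nat) : 0 < n.+2%:R :> R by [].
have Ipos n r : I n r -> 0 < r.
  by rewrite /I /= in_itv /= => /andP[+ _]; apply: lt_le_trans; rewrite invr_gt0.
have f0 (r : R) : 0 < r -> 0 <= f r.
  move=> r0; rewrite /f mulr_ge0 ?expR_ge0 // divr_ge0 ?(ltW a0) //.
  by rewrite mulr_ge0 ?(ltW r0) // addr_ge0 // mulr_ge0 ?(ltW t0) ?(ltW r0).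
have dF (r : R) : 0 < r -> is_derive r 1 (saturated_pow alpha t) (f r).
  by move=> r0; exact: is_derive_saturated_pow.
have cF (r : R) : 0 < r -> {for r, continuous (saturated_pow alpha t)}.
  move=> /dF [dr _]; apply: differentiable_continuous; exact/derivable1_diffP.
have cf (r : R) : 0 < r -> {for r, continuous f}.
  move=> r0; apply: continuousM; first exact: cF.
  apply: continuousM; first exact: cst_continuous.
  apply: continuousV; first by rewrite gt_eqF // mulr_gt0 // addr_gt0 // mulr_gt0.
  apply: continuousM; first exact: cvg_id.
  apply: continuousD; first exact: cst_continuous.
  by apply: continuousM; [exact: cst_continuous | exact: cvg_id].
have cfI n : {within I n, continuous f}.
  apply: continuous_in_subspaceT => r; rewrite inE => /Ipos; exact: cf.
have mfI n : measurable_fun (I n) f.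
  apply: subspace_continuous_measurable_fun => //; exact: measurable_itv.
have IE : `]0, +oo[%classic = \bigcup_n I n.
  apply/seteqP; split => r /=; last by case=> n _ /Ipos; rewrite in_itv /= andbT.
  rewrite in_itv /= andbT => r0.
  pose k := Num.bound (r + r^-1).
  have kr : r + r^-1 < k%:R.
    by apply: archi_boundP; rewrite addr_ge0 ?invr_ge0 ?(ltW r0).
  have iv0 : 0 < r^-1 by rewrite invr_gt0.
  have k2 : k%:R <= k.+2%:R :> R by rewrite ler_nat; lia.
  exists k => //; rewrite /I /= in_itv /=; apply/andP; split; last by lra.
  by rewrite -[leRHS]invrK lef_pV2 ?posrE //; lra.
have ndI : nondecreasing_seq I.
  apply/nondecreasing_seqP => n; rewrite subsetEset /I => r /=.
  rewrite !in_itv /= => /andP[h1 h2].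
  have h3 : n.+2%:R <= n.+3%:R :> R by rewrite ler_nat.
  rewrite (le_trans h2 h3) andbT; apply: le_trans h1.
  by rewrite lef_pV2 ?posrE.
rewrite IE.
have mI n : measurable (I n) by exact: measurable_itv.
have mfE n : measurable_fun (I n) (EFin \o f) by exact/measurable_EFinP.
have f0E n r : I n r -> (0 <= (EFin \o f) r)%E by move=> /Ipos/f0; rewrite lee_fin.
have /cvg_lim <- // := @ge0_nondecreasing_set_cvg_integral _ _ _ _ _ mu ndI mI mfE f0E.
apply: lime_le.
  apply: ereal_nondecreasing_is_cvgn.
  exact: ge0_nondecreasing_set_nondecreasing_integral.
apply: nearW => n.
have nn : (n.+2%:R)^-1 < n.+2%:R :> R.
  by apply: lt_trans (_ : 1 < _); rewrite ?invf_lt1 // ltr1n.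
rewrite (@continuous_FTC2 _ f (saturated_pow alpha t) _ _ nn) //.
- rewrite -EFinB lee_fin lerBlDr; apply: (le_trans (saturated_pow_le a0 t0 (n2 n))).
  by rewrite lerDl expR_ge0.
- exact: cfI.
- have i0 : 0 < (n.+2%:R)^-1 :> R by rewrite invr_gt0.
  split.
  + move=> r; rewrite in_itv /= => /andP[h _].
    by have [] := dF r (lt_trans i0 h).
  + by apply: cvg_at_right_filter; exact: cF.
  + by apply: cvg_at_left_filter; exact: cF.
- move=> r; rewrite in_itv /= => /andP[h _].
  have i0 : 0 < (n.+2%:R)^-1 :> R by rewrite invr_gt0.
  have [dr <-] := dF r (lt_trans i0 h).
  by rewrite derive1E.
Qed.

Lemma measurable_expkernel (D : set R) (rho alpha : R) :
  measurable_fun D (expkernel rho alpha).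
Proof.
apply: (@measurable_funS _ _ _ _ setT) => //.
apply: measurable_funM; last exact: measurable_powR.
apply: measurableT_comp; first exact: measurable_expR.
by apply: measurableT_comp => //; exact: mulrl_measurable.
Qed.

Lemma expkernel_ge0 (rho alpha r : R) : 0 <= expkernel rho alpha r.
Proof. by rewrite mulr_ge0 ?expR_ge0 ?powR_ge0. Qed.

(** With y = t r, q = 1 + y and alpha <= 1, the derivative of [saturated_pow] is at
least alpha r^(alpha-1) / q^2, and e^(-rho y) is at most a constant times q^-2, because
e^(rho y / 2) >= 1 + rho y / 2 >= min(1, rho/2) (1 + y). *)
Lemma expkernel_le (rho alpha : R) : 0 < rho -> 0 < alpha <= 1 ->
  exists2 C : R, 0 < C & forall t r, 0 < t -> 0 < r ->
  expkernel (rho * t) alpha r <= C * (saturated_pow alpha t r * (alpha / (r * (1 + t * r)))).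
Proof.
move=> rho0 /andP[a0 a1].
pose d : R := Num.min 1 (rho / 2).
have d0 : 0 < d by rewrite lt_min ltr01 divr_gt0.
exists (alpha^-1 / d ^+ 2); first by rewrite divr_gt0 ?invr_gt0 ?exprn_gt0.
move=> t r t0 r0.
have y0 : 0 < t * r by rewrite mulr_gt0.
set q := 1 + t * r.
have q0 : 0 < q by rewrite addr_gt0.
have Sq : r `^ alpha / q <= saturated_pow alpha t r.
  rewrite /saturated_pow mulrBr expRB /powR gt_eqF // ler_wpM2l ?expR_ge0 //.
  rewrite -/q lef_pV2 ?posrE ?expR_gt0 // -[leRHS](lnK (x := q)) ?posrE //.
  by rewrite ler_expR ler_piMl // ln_ge0 // lerDl ltW.
have exq : expR (- (rho * t * r)) <= (d ^+ 2 * q ^+ 2)^-1.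
  rewrite expRN lef_pV2 ?posrE ?expR_gt0 ?mulr_gt0 ?exprn_gt0 //.
  have -> : expR (rho * t * r) = expR (rho / 2 * (t * r)) ^+ 2.
    by rewrite expr2 -expRD; congr expR; field.
  rewrite -exprMn ler_pXn2r ?nnegrE ?expR_ge0 ?mulr_ge0 ?(ltW d0) ?(ltW q0) //.
  apply: le_trans (expR_ge1Dx _); rewrite mulrDr mulr1 lerD //.
    by rewrite ge_min lexx.
  by rewrite ler_pM2r // ge_min lexx orbT.
have -> : alpha^-1 / d ^+ 2 * (saturated_pow alpha t r * (alpha / (r * q))) =
    saturated_pow alpha t r / (d ^+ 2 * (r * q)) by field; rewrite !gt_eqF.
apply: (@le_trans _ _ (r `^ alpha / q / (d ^+ 2 * (r * q)))); last first.
  by rewrite ler_wpM2r // invr_ge0 mulr_ge0 ?sqr_ge0 // mulr_ge0 ?(ltW r0) ?(ltW q0).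
have -> : r `^ alpha / q / (d ^+ 2 * (r * q)) = (d ^+ 2 * q ^+ 2)^-1 * (r `^ alpha / r).
  by field; rewrite !gt_eqF.
rewrite /expkernel powRB ?(gt_eqF r0) ?implybT // powRr1 ?(ltW r0) //.
by rewrite ler_wpM2r // divr_ge0 ?powR_ge0 // ltW.
Qed.

Lemma expkernel_integral_le (rho alpha : R) : 0 < rho -> 0 < alpha <= 1 ->
  exists2 C : R, 0 < C & forall t, 0 < t ->
  (\int[mu]_(r in `]0%R, +oo[) (expkernel (rho * t) alpha r)%:E
    <= (C * t `^ (- alpha))%:E)%E.
Proof.
move=> rho0 ha; have [C C0 HC] := expkernel_le rho0 ha.
exists C => // t t0; have /andP[a0 a1] := ha.
set D : set R := `]0%R, +oo[%classic.
have Dpos r : D r -> 0 < r by rewrite /D /= in_itv /= andbT.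
pose f r := saturated_pow alpha t r * (alpha / (r * (1 + t * r))).
have f0 (r : R) : 0 < r -> 0 <= f r.
  move=> r0; rewrite /f mulr_ge0 ?expR_ge0 // divr_ge0 ?(ltW a0) //.
  by rewrite mulr_ge0 ?(ltW r0) // addr_ge0 // mulr_ge0 ?(ltW t0) ?(ltW r0).
have mf : measurable_fun D f.
  apply: open_continuous_measurable_fun; first exact: interval_open.
  move=> r; rewrite inE => /Dpos r0.
  have [dr _] := is_derive_saturated_pow alpha t0 r0.
  apply: continuousM; first by apply: differentiable_continuous; exact/derivable1_diffP.
  apply: continuousM; first exact: cst_continuous.
  apply: continuousV; first by rewrite gt_eqF // mulr_gt0 // addr_gt0 // mulr_gt0.
  apply: continuousM; first exact: cvg_id.
  apply: continuousD; first exact: cst_continuous.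
  by apply: continuousM; [exact: cst_continuous | exact: cvg_id].
have mD : measurable D by exact: measurable_itv.
apply: (@le_trans _ _ (\int[mu]_(r in D) (C%:E * (f r)%:E))%E).
  apply: ge0_le_integral => //.
  - by move=> r _; rewrite lee_fin expkernel_ge0.
  - by apply/measurable_EFinP; exact: measurable_expkernel.
  - by apply/measurable_EFinP; apply: measurable_funM.
  - by move=> r /Dpos r0; rewrite -EFinM lee_fin HC.
rewrite ge0_integralZl //.
- by rewrite EFinM lee_wpmul2l ?lee_fin ?(ltW C0) // saturated_pow_integral_le.
- exact/measurable_EFinP.
- by move=> r /Dpos r0; rewrite lee_fin f0.
- by rewrite lee_fin ltW.
Qed.

End KernelIntegral.

Section VectorIntegral.
Context d (T : measurableType d) (R : realType).
Variable mu : {measure set T -> \bar R}.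

Lemma integrable_Rsum (I : Type) (s : seq I) (D : set T) (f : I -> T -> R) :
  measurable D -> (forall i, mu.-integrable D (EFin \o f i)) ->
  mu.-integrable D (EFin \o (fun x => \sum_(i <- s) f i x)).
Proof.
move=> mD fi.
apply: (@eq_integrable _ _ _ mu _ mD (fun x => \sum_(i <- s) (EFin \o f i) x)%E).
  by move=> x _; rewrite /= sumEFin.
exact: integrable_sum.
Qed.

Lemma Rintegral_sum (I : Type) (s : seq I) (D : set T) (f : I -> T -> R) :
  measurable D -> (forall i, mu.-integrable D (EFin \o f i)) ->
  (\int[mu]_(x in D) (\sum_(i <- s) f i x))%R = \sum_(i <- s) (\int[mu]_(x in D) f i x)%R.
Proof.
move=> mD fi; elim: s => [|i s IH].
  by rewrite big_nil; under eq_Rintegral do rewrite big_nil; rewrite Rintegral_cst // mul0r.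
rewrite big_cons -IH -RintegralD //; last exact: integrable_Rsum.
by apply: eq_Rintegral => x _; rewrite big_cons.
Qed.

(** The Euclidean norm of a vector-valued integral is at most the integral
of the norm.  With e the vector of the integrals, |e|^2 is the integral of the
scalar product of e with the integrand, which is at most |e| times the norm of
the integrand.  The crude bound [B] only ensures integrability. *)
Lemma Rintegral_l2_le (n : nat) (D : set T) (m : T -> R) (U W : 'I_n -> T -> R)
    (B E J : R) : measurable D ->
  measurable_fun D m -> (forall x, D x -> 0 <= m x) ->
  (\int[mu]_(x in D) (m x)%:E <= J%:E)%E ->
  (forall i, measurable_fun D (U i)) -> (forall i, measurable_fun D (W i)) ->
  (forall i x, D x -> `|U i x| <= B * m x) ->
  (forall i x, D x -> `|W i x| <= B * m x) ->
  0 <= E ->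
  (forall x, D x -> \sum_i (U i x - W i x) ^+ 2 <= (E * m x) ^+ 2) ->
  \sum_i ((\int[mu]_(x in D) U i x)%R - (\int[mu]_(x in D) W i x)%R) ^+ 2
    <= (E * J) ^+ 2.
Proof.
move=> mD mm m0 mJ mU mW UB WB E0 UW.
have im : mu.-integrable D (EFin \o m).
  apply/integrableP; split; first exact/measurable_EFinP.
  rewrite (eq_integral (EFin \o m)); first exact: le_lt_trans mJ (ltry _).
  by move=> x; rewrite inE => Dx; rewrite gee0_abs // lee_fin m0.
have ikm (k : R) : mu.-integrable D (EFin \o (fun x => k * m x)).
  have := integrableZl mD k im; apply: eq_integrable => // x _.
have dom (V : T -> R) (k : R) : measurable_fun D V ->
    (forall x, D x -> `|V x| <= k * m x) -> mu.-integrable D (EFin \o V).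
  move=> mV Vk; apply: le_integrable (ikm k) => //; first exact/measurable_EFinP.
  by move=> x Dx /=; rewrite lee_fin (le_trans (Vk _ Dx)) // ler_norm.
have iU i : mu.-integrable D (EFin \o U i) by apply: dom (mU i) (UB i).
have iW i : mu.-integrable D (EFin \o W i) by apply: dom (mW i) (WB i).
set e := fun i => (\int[mu]_(x in D) U i x)%R - (\int[mu]_(x in D) W i x)%R.
have iUW i : mu.-integrable D (EFin \o (fun x => U i x - W i x)).
  have := integrableB mD (iU i) (iW i); apply: eq_integrable => // x _.
have eE i : e i = (\int[mu]_(x in D) (U i x - W i x))%R by rewrite RintegralB.
set Q := \sum_i e i ^+ 2.
have Q0 : 0 <= Q by apply: sumr_ge0 => i _; exact: sqr_ge0.
have J0 : 0 <= J.
  by rewrite -lee_fin; apply: le_trans mJ; apply: integral_ge0 => x Dx; rewrite lee_fin m0.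
have iUWe i : mu.-integrable D (EFin \o (fun x => e i * (U i x - W i x))).
  have := integrableZl mD (e i) (iUW i); apply: eq_integrable => // x _.
have QE : Q = (\int[mu]_(x in D) \sum_i e i * (U i x - W i x))%R.
  rewrite Rintegral_sum //; apply: eq_bigr => i _.
  by rewrite RintegralZl // -eE expr2.
(* Cauchy-Schwarz at every point x. *)
have QI : Q <= \int[mu]_(x in D) (Num.sqrt Q * E * m x).
  rewrite {1}QE; apply: le_Rintegral => //.
    exact: integrable_Rsum.
  move=> x Dx; apply: le_trans (ler_norm _) _.
  rewrite -(ler_pXn2r (n := 2)) ?nnegrE //; last first.
    by rewrite mulr_ge0 ?m0 // mulr_ge0 // sqrtr_ge0.
  rewrite real_normK ?num_real //; apply: le_trans (sqr_sum_le _ _ _ _) _.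
  rewrite -mulrA exprMn sqr_sqrtr // ler_wpM2l //; exact: UW.
have mJ' : \int[mu]_(x in D) m x <= J.
  rewrite -lee_fin /Rintegral fineK //.
  exact: integrable_fin_num.
have : Q <= Num.sqrt Q * (E * J).
  apply: le_trans QI _; rewrite RintegralZl // -mulrA ler_wpM2l ?sqrtr_ge0 //.
  by rewrite ler_wpM2l.
have [->|Qn0] := eqVneq Q 0; first by rewrite sqr_ge0.
have sQ : 0 < Num.sqrt Q by rewrite sqrtr_gt0 lt_neqAle eq_sym Qn0.
rewrite -{1}(sqr_sqrtr Q0) expr2 ler_pM2l // => h.
by rewrite -(sqr_sqrtr Q0) ler_pXn2r ?nnegrE ?sqrtr_ge0 // mulr_ge0.
Qed.

End VectorIntegral.

(** * Resolvent error at a fixed point of the contour *)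

Section ResolventError.
Import ComplexField.Normc.
Local Open Scope complex_scope.
Variable R : realType.

Lemma normc_ge0 (z : R[i]) : 0 <= normc z.
Proof. by case: z => a b; exact: sqrtr_ge0. Qed.

(** A scale-free form of the statement that w avoids a sector around the negative
real axis; it is the only property of z^alpha that the estimates use. *)
Definition in_sector (s : R) (w : R[i]) := forall l : R, 0 <= l -> s * l <= normc (w + l%:C).

(** |w + l|^2 = (rho + l cos psi)^2 + l^2 sin^2 psi when w = rho e^(i psi). *)
Lemma in_sector_polar (rho psi : R) :
  in_sector `|sin psi| ((rho * cos psi) +i* (rho * sin psi)).
Proof.
move=> l l0; rewrite /normc /=.
rewrite -[leLHS]ger0_norm ?mulr_ge0 // -sqrtr_sqr ler_wsqrtr //.
rewrite exprMn real_normK ?num_real // addr0.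
have -> : (rho * cos psi + l) ^+ 2 + (rho * sin psi) ^+ 2 =
   sin psi ^+ 2 * l ^+ 2 + (rho + l * cos psi) ^+ 2
     + (rho ^+ 2 - l ^+ 2) * (cos psi ^+ 2 + sin psi ^+ 2 - 1) by ring.
by rewrite cos2Dsin2 subrr mulr0 addr0 lerDl sqr_ge0.
Qed.

Variables (w : R[i]) (s : R).
Hypotheses (s0 : 0 < s) (s1 : s <= 1) (ws : in_sector s w).

Lemma sector_neq0 (l : R) : 0 < l -> w + l%:C != 0.
Proof.
move=> l0; apply/eqP => e; have := ws (ltW l0).
by rewrite e normc0 leNgt mulr_gt0.
Qed.

Lemma normc_resolvent_le (l : R) : 0 < l -> normc (w + l%:C)^-1 <= (s * l)^-1.
Proof.
move=> l0; rewrite normcV lef_pV2 ?posrE ?mulr_gt0 //; first exact: ws (ltW l0).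
by apply: lt_le_trans (ws (ltW l0)); rewrite mulr_gt0.
Qed.

(** The resolvent identity. *)
Lemma normc_resolventB_le (l m : R) : 0 < l -> 0 < m -> m <= l ->
  normc ((w + l%:C)^-1 - (w + m%:C)^-1) <= (l - m) / (s ^+ 2 * (l * m)).
Proof.
move=> l0 m0 ml.
have -> : (w + l%:C)^-1 - (w + m%:C)^-1 = (m - l)%:C * ((w + l%:C)^-1 * (w + m%:C)^-1).
  rewrite rmorphB /=; have := sector_neq0 l0; have := sector_neq0 m0.
  move: l%:C m%:C => x y hy hx; field; first by rewrite hy hx.
rewrite !normcM.
have -> : normc (m - l)%:C = l - m.
  by rewrite /normc /= expr0n addr0 sqrtr_sqr distrC ger0_norm ?subr_ge0.
rewrite ler_wpM2l ?subr_ge0 //.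
have -> : (s ^+ 2 * (l * m))^-1 = (s * l)^-1 * (s * m)^-1.
  by field; rewrite !gt_eqF.
by rewrite ler_pM ?normc_resolvent_le ?normc_ge0.
Qed.

(** The coefficient by which the exact and the discrete resolvent differ on mode
k; the scheme ignores the modes k >= N. *)
Definition resolvent_gap (N k : nat) : R[i] :=
  (w + (lambda R k)%:C)^-1 - (if (k < N)%N then (w + (fdmx_eig R N k)%:C)^-1 else 0).

(** For k < N the resolvent identity gives
(lambda_k - mu_k) / (s^2 lambda_k mu_k), in which [fdmx_eig_bounds] makes
lambda_k cancel; for k >= N only 1 / (s lambda_k) is present. *)
Lemma normc_resolvent_gap_le (N k : nat) : (0 < N)%N -> (0 < k)%N ->
  normc (resolvent_gap N k) * (maxn k N)%:R ^+ 2 <= (s ^+ 2)^-1.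
Proof.
move=> N0 k0.
have l0 := lambda_gt0 R k0.
rewrite /resolvent_gap; case: (ltnP k N) => kN.
  have NR : 0 < N%:R :> R by rewrite ltr0n.
  have [b1 [b2 b3]] := @fdmx_eig_bounds R N k (introT andP (conj k0 kN)).
  have m0 : 0 < fdmx_eig R N k by apply: lt_le_trans b1; rewrite divr_gt0.
  rewrite -ler_pdivlMr ?exprn_gt0 //.
  move: (lambda R k) (fdmx_eig R N k) l0 b1 b2 b3 m0 => L m l0 b1 b2 b3 m0.
  apply: le_trans (normc_resolventB_le l0 m0 b3) _.
  apply: (@le_trans _ _ (L ^+ 2 / (4 * N%:R ^+ 2) /
      (s ^+ 2 * (L * (L / 4))))).
    apply: ler_pM; rewrite ?subr_ge0 //.
      by rewrite invr_ge0 mulr_ge0 ?sqr_ge0 // mulr_ge0 ?(ltW l0) ?(ltW m0).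
    rewrite lef_pV2 ?posrE ?mulr_gt0 ?exprn_gt0 ?divr_gt0 //.
    by rewrite ler_wpM2l ?sqr_ge0 // ler_wpM2l ?(ltW l0).
  rewrite le_eqVlt; apply/orP; left; apply/eqP.
  by field; rewrite !gt_eqF.
rewrite subr0.
apply: (@le_trans _ _ ((s * lambda R k)^-1 * lambda R k)).
  by rewrite ler_pM ?normc_resolvent_le ?normc_ge0 ?sqr_ge0 ?lambda_ge_sqr.
have -> : (s * lambda R k)^-1 * lambda R k = s^-1.
  by field; rewrite (gt_eqF l0) (gt_eqF s0).
by rewrite lef_pV2 ?posrE ?exprn_gt0 // expr2 ler_piMl // ltW.
Qed.

Variable part : R[i] -> R.
Hypotheses (partB : forall x y, part (x - y) = part x - part y)
  (partZ : forall z a, part (z * a%:C) = part z * a)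
  (part_le : forall z, `|part z| <= normc z).

Variables (c : nat -> R) (sigma S : R).
Hypotheses (c0 : c 0%N = 0) (sigma0 : 0 <= sigma)
  (cS : forall n, \sum_(1 <= k < n) lambda R k `^ sigma * c k ^+ 2 <= S).

Definition exact_mode (x : R) (k : nat) : R[i] :=
  (w + (lambda R k)%:C)^-1 * (phi k x)%:C * (c k)%:C.

Definition fd_mode (N : nat) (x : R) (k : nat) : R[i] :=
  (w + (fdmx_eig R N k)%:C)^-1 * (c k)%:C * (phi k x)%:C.

(** The value at k = 0 is set to 0: there is no such mode, and 1/w is not bounded on
the sector. *)
Definition gap_coef (N : nat) (k : nat) : R :=
  if k is 0%N then 0 else part (resolvent_gap N k).

Lemma gap_coef_le (N : nat) : (0 < N)%N -> forall k,
  `|gap_coef N k| * (maxn k N)%:R ^+ 2 <= (s ^+ 2)^-1.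
Proof.
move=> N0 [|k]; first by rewrite normr0 mul0r invr_ge0 sqr_ge0.
apply: le_trans (normc_resolvent_gap_le N0 (ltn0Sn k)).
by rewrite ler_wpM2r ?sqr_ge0 // part_le.
Qed.

Let gap_term N x k := gap_coef N k * c k * phi k x.

Let part0 : part 0 = 0.
Proof. by rewrite -[X in part X](subrr 0) partB subrr. Qed.

Let partD x y : part (x + y) = part x + part y.
Proof.
by rewrite -[X in part (_ + X)]opprK partB -(sub0r y) partB part0 sub0r opprK.
Qed.

Lemma part_sum (r : seq nat) (F : nat -> R[i]) :
  part (\sum_(k <- r) F k) = \sum_(k <- r) part (F k).
Proof. by elim: r => [|k r IH]; rewrite ?big_nil ?part0 // !big_cons partD IH. Qed.

Lemma sum_gap_termE (N n : nat) (x : R) : (N <= n)%N -> (0 < N)%N ->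
  \sum_(1 <= k < n) gap_term N x k =
  \sum_(1 <= k < n) part (exact_mode x k) - part (\sum_(1 <= k < N) fd_mode N x k).
Proof.
move=> Nn N0.
have termE k : (0 < k)%N -> gap_term N x k = part (exact_mode x k) -
    (if (k < N)%N then part (fd_mode N x k) else 0).
  case: k => // k _; rewrite /gap_term /gap_coef /resolvent_gap /exact_mode /fd_mode partB.
  by rewrite !partZ; case: ifP => _; rewrite ?partZ ?part0; ring.
rewrite part_sum (eq_big_nat _ _ (F2 := fun k => part (exact_mode x k) -
    (if (k < N)%N then part (fd_mode N x k) else 0))); last first.
  by move=> k /andP[k0 _]; exact: termE.
rewrite big_split /= sumrN; congr (_ - _).
rewrite (big_cat_nat _ (n := N)) //= [X in _ + X]big1_seq ?addr0.
  by apply: eq_big_nat => k /andP[_ ->].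
by move=> k /andP[_]; rewrite mem_index_iota => /andP[Nk _]; rewrite ltnNge Nk.
Qed.

(** Absolute convergence and the bound on the sum both come from
[node_sum_linf] applied to the partial sums. *)
Lemma cvg_gap_series (N : nat) (x : R) : (0 < N)%N ->
  forall T, (forall n, \sum_(1 <= k < n) mode_weight sigma N k <= T) ->
  cvgn (fun n => \sum_(1 <= k < n) gap_term N x k) /\
  (limn (fun n => \sum_(1 <= k < n) gap_term N x k)) ^+ 2 <= 4 * (s ^+ 2)^-1 ^+ 2 * T * S.
Proof.
move=> N0 T hT; set B := 4 * _ * T * S.
have S0 : 0 <= S by apply: le_trans (cS 0%N); rewrite big_geq.
have T0 : 0 <= T by apply: le_trans (hT 0%N); rewrite big_geq.
have absB n : (\sum_(1 <= k < n) `|gap_term N x k|) ^+ 2 <= B.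
  have hk k : (0 < k)%N -> `|gap_coef N k| * (maxn k N)%:R ^+ 2 <= (s ^+ 2)^-1.
    by move=> _; exact: gap_coef_le.
  apply: le_trans (node_sum_linf x sigma0 hk (cS n)) _.
  by rewrite ler_wpM2r // ler_wpM2l // mulr_ge0 ?sqr_ge0.
have B0 : 0 <= B by apply: le_trans (absB 0%N); rewrite sqr_ge0.
have serE (f : nat -> R) n : f 0%N = 0 -> \sum_(1 <= k < n) f k = series f n.
  move=> f0; rewrite /series /=; case: n => [|n]; first by rewrite !big_geq.
  by rewrite [RHS]big_ltn // f0 add0r.
have t0 : gap_term N x 0%N = 0 by rewrite /gap_term mul0r mul0r.
have cv : cvgn (series (gap_term N x)).
  apply: normed_cvg; apply: nondecreasing_is_cvgn.
    by apply: nondecreasing_series => n _ _; exact: normr_ge0.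
  exists (Num.sqrt B) => _ [n _ <-].
  rewrite -[leLHS](serE (fun k => `|gap_term N x k|) n) ?t0 ?normr0 //.
  rewrite -[leLHS]ger0_norm ?sumr_ge0 // -sqrtr_sqr ler_wsqrtr //.
have -> : (fun n => \sum_(1 <= k < n) gap_term N x k) = series (gap_term N x).
  by apply/funext => n; rewrite serE.
split => //.
have c2 : (fun n => series (gap_term N x) n ^+ 2) @ \oo --> (limn (series (gap_term N x)) : R) ^+ 2.
  by under eq_fun do rewrite expr2; rewrite expr2; exact: cvgM.
rewrite -(cvg_lim _ c2) //; apply: limr_le; first by apply/cvg_ex; eexists; exact: c2.
apply: nearW => n; apply: le_trans (absB n).
rewrite -serE // -[leLHS]real_normK ?num_real // ler_pXn2r ?nnegrE ?sumr_ge0 //.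
exact: ler_norm_sum.
Qed.

Definition exact_sum (x : R) : R := limn (fun n => \sum_(1 <= k < n) part (exact_mode x k)).

(** A bound uniform in N is enough for convergence and for
integrability. *)
Lemma sum_mode_weight_le2 (N n : nat) : (0 < N)%N -> \sum_(1 <= k < n) mode_weight sigma N k <= 2.
Proof.
move=> N0; case: n => [|n]; first by rewrite big_geq.
apply: (@le_trans _ _ (\sum_(1 <= k < n.+1) mode_weight sigma 1 k)).
  rewrite big_nat_cond [leRHS]big_nat_cond; apply: ler_sum => k /andP[/andP[k0 _] _].
  rewrite /mode_weight ler_wpM2l ?powR_ge0 // lef_pV2 ?posrE ?exprn_gt0 ?ltr0n ?leq_max ?k0 //.
  by rewrite ler_pXn2r ?nnegrE // ler_nat (maxn_idPl k0) leq_maxl.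
apply: le_trans (sum_mode_weight_tail sigma0 (ltn0Sn 0) (ltn0Sn n)) _.
by rewrite powR1 mulr1.
Qed.

Lemma cvg_exact_sum (x : R) :
  cvgn (fun n => \sum_(1 <= k < n) part (exact_mode x k)) /\
  exact_sum x ^+ 2 <= 4 * (s ^+ 2)^-1 ^+ 2 * 2 * S.
Proof.
have [] := cvg_gap_series x (ltn0Sn 0) (fun m => @sum_mode_weight_le2 1 m (ltn0Sn 0)).
suff -> : (fun n => \sum_(1 <= k < n) gap_term 1 x k) =
  (fun n => \sum_(1 <= k < n) part (exact_mode x k)) by [].
apply/funext => -[|n]; first by rewrite !big_geq.
by rewrite sum_gap_termE // (big_geq (leqnn 1)) part0 subr0.
Qed.

Lemma lim_gap_seriesE (N : nat) (x : R) : (0 < N)%N ->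
  limn (fun n => \sum_(1 <= k < n) gap_term N x k) =
  exact_sum x - part (\sum_(1 <= k < N) fd_mode N x k).
Proof.
move=> N0; apply/cvg_lim => //; have [cv _] := cvg_exact_sum x.
apply: cvg_trans (cvgB cv (cvg_cst (part (\sum_(1 <= k < N) fd_mode N x k)))).
apply: near_eq_cvg; near=> n.
rewrite sum_gap_termE //; near: n; exact: nbhs_infty_ge.
Unshelve. all: by end_near. Qed.

Lemma resolvent_error_linf (N : nat) (x T : R) : (0 < N)%N ->
  (forall n, \sum_(1 <= k < n) mode_weight sigma N k <= T) ->
  (exact_sum x - part (\sum_(1 <= k < N) fd_mode N x k)) ^+ 2
    <= 4 * (s ^+ 2)^-1 ^+ 2 * T * S.
Proof. by move=> N0 hT; rewrite -lim_gap_seriesE //; have [] := cvg_gap_series x N0 hT. Qed.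

(** A bound that does not depend on the point w of the sector, used only to
know that the integrands are integrable. *)
Lemma exact_fd_sum_bound (N : nat) (x : R) : (0 < N)%N ->
  `|exact_sum x| <= 2 * Num.sqrt (4 * (s ^+ 2)^-1 ^+ 2 * 2 * S) /\
  `|part (\sum_(1 <= k < N) fd_mode N x k)| <= 2 * Num.sqrt (4 * (s ^+ 2)^-1 ^+ 2 * 2 * S).
Proof.
move=> N0; set B := 4 * _ * 2 * S.
have [_ h1] := cvg_exact_sum x.
have h2 := resolvent_error_linf x N0 (fun m => @sum_mode_weight_le2 N m N0).
have abs (y : R) : y ^+ 2 <= B -> `|y| <= Num.sqrt B.
  by move=> yB; rewrite -sqrtr_sqr ler_wsqrtr.
have {}h1 := abs _ h1; have {}h2 := abs _ h2.
have sB : 0 <= Num.sqrt B by exact: sqrtr_ge0.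
split; first by lra.
move: h1 h2; set d := part _; move=> h1 h2.
have -> : d = exact_sum x - (exact_sum x - d) by ring.
by apply: le_trans (ler_normB _ _) _; lra.
Qed.

(** [node_sum_l2] bounds the partial sums over whole blocks of
frequencies; let the number of blocks tend to infinity. *)
Lemma resolvent_error_l2 (n : nat) :
  \sum_(i < n) (exact_sum (i.+1%:R / n.+1%:R) -
     part (\sum_(1 <= k < n.+1) fd_mode n.+1 (i.+1%:R / n.+1%:R) k)) ^+ 2
  <= 8 * n.+1%:R * ((s ^+ 2)^-1 / n.+1%:R ^+ 2) ^+ 2 * S.
Proof.
pose V m (x : R) : R := \sum_(1 <= k < m) gap_term n.+1 x k.
have cvV x : (fun M => V (M * n.+1)%N x) @ \oo -->
    exact_sum x - part (\sum_(1 <= k < n.+1) fd_mode n.+1 x k).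
  rewrite -lim_gap_seriesE //.
  have [cv _] := cvg_gap_series x (ltn0Sn n) (fun m => @sum_mode_weight_le2 n.+1 m (ltn0Sn n)).
  apply: (@cvg_comp _ _ _ (fun M => M * n.+1)%N (fun m => V m x) _ \oo) cv.
  apply/cvgnyPge => A; near=> M.
  by apply: (@leq_trans M); [near: M; exact: nbhs_infty_ge | rewrite leq_pmulr].
have cvS : (fun M => \sum_(i < n) V (M * n.+1)%N (i.+1%:R / n.+1%:R) ^+ 2) @ \oo -->
    \sum_(i < n) (exact_sum (i.+1%:R / n.+1%:R) -
     part (\sum_(1 <= k < n.+1) fd_mode n.+1 (i.+1%:R / n.+1%:R) k)) ^+ 2.
  apply: cvg_big => [|i _]; first exact: add_continuous.
  under eq_fun do rewrite expr2; rewrite expr2.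
  by apply: cvgM; exact: cvV.
rewrite -(cvg_lim _ cvS) //; apply: limr_le; first by apply/cvg_ex; eexists; exact: cvS.
apply: nearW => M.
have VE x : V (M * n.+1)%N x = \sum_(k < M * n.+1) gap_term n.+1 x k.
  rewrite /V -(big_mkord xpredT); case: M => [|M]; first by rewrite !big_geq.
  have t0 : gap_term n.+1 x 0 = 0 by rewrite /gap_term /gap_coef !mul0r.
  by rewrite [RHS]big_ltn ?muln_gt0 // t0 add0r.
under eq_bigr do rewrite VE.
rewrite (sum_interior_nodes n (F := fun j =>
    (\sum_(k < M * n.+1) gap_term n.+1 (j%:R / n.+1%:R) k) ^+ 2)).
  apply: node_sum_l2 => //; first exact: gap_coef_le.
  apply: le_trans (cS (M * n.+1)%N).
  rewrite -(big_mkord xpredT (fun k => c k ^+ 2)).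
  case: M {VE} => [|M]; first by rewrite !big_geq.
  rewrite big_ltn ?muln_gt0 // c0 expr0n add0r.
  rewrite big_nat_cond [leRHS]big_nat_cond; apply: ler_sum => k /andP[/andP[k0 _] _].
  rewrite ler_peMl ?sqr_ge0 // -(powRr0 (lambda R k)) ler_powR //.
  apply: le_trans (lambda_ge_sqr R k); rewrite expr_ge1 // ler1n //.
rewrite big1 ?expr0n // => k _; by rewrite mul0r /gap_term phi_at0 mulr0.
Unshelve. all: by end_near. Qed.

End ResolventError.

(** * From the contour to integrals over the half-line *)

Section Contour.
Import ComplexField.Normc.
Local Open Scope complex_scope.
Variable R : realType.
Local Notation mu := (@lebesgue_measure R).
Local Notation posR := (`]0%R, +oo[%classic : set R).
Local Notation Re := (@complex.Re R).
Local Notation Im := (@complex.Im R).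

Lemma ReB (x y : R[i]) : Re (x - y) = Re x - Re y.
Proof. by case: x y => [a b] [c d]. Qed.

Lemma ImB (x y : R[i]) : Im (x - y) = Im x - Im y.
Proof. by case: x y => [a b] [c d]. Qed.

Lemma ReM_real (z : R[i]) (a : R) : Re (z * a%:C) = Re z * a.
Proof. by case: z => [x y] /=; rewrite mulr0 subr0. Qed.

Lemma ImM_real (z : R[i]) (a : R) : Im (z * a%:C) = Im z * a.
Proof. by case: z => [x y] /=; rewrite mulr0 add0r. Qed.

Lemma Re_le_normc (z : R[i]) : `|Re z| <= normc z.
Proof. by case: z => [x y]; rewrite -sqrtr_sqr ler_wsqrtr // lerDl sqr_ge0. Qed.

Lemma Im_le_normc (z : R[i]) : `|Im z| <= normc z.
Proof. by case: z => [x y]; rewrite -sqrtr_sqr ler_wsqrtr // lerDr sqr_ge0. Qed.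

Lemma normc_ray (psi r : R) : 0 < r -> normc (ray psi r) = r.
Proof.
move=> r0; rewrite /normc /ray !exprMn -mulrDr cos2Dsin2 mulr1 sqrtr_sqr.
by rewrite gtr0_norm.
Qed.

(** The two half-lines that make up the contour. *)
Definition contour_angle (theta psi : R) := psi = theta \/ psi = - theta.

Lemma Arg_ray (theta psi r : R) : 0 < theta < pi -> contour_angle theta psi ->
  0 < r -> Arg (ray psi r) = psi.
Proof.
move=> /andP[t0 tp] psiE r0; rewrite /Arg normc_ray //= mulrAC mulfV ?gt_eqF // mul1r.
have sp : 0 < sin theta by apply: sin_gt0_pi; rewrite t0.
have aK : acos (cos theta) = theta by rewrite cosK // in_itv /= !ltW.
case: psiE => ->; first by rewrite pmulr_rge0 // ltW ?aK.
by rewrite sinN pmulr_rge0 // oppr_ge0 leNgt sp /= cosN aK.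
Qed.

Lemma cpow_ray (theta psi r a : R) : 0 < theta < pi -> contour_angle theta psi ->
  0 < r -> cpow (ray psi r) a = (r `^ a * cos (a * psi)) +i* (r `^ a * sin (a * psi)).
Proof.
move=> ht hp r0; rewrite /cpow normc_ray // (Arg_ray ht hp r0).
by apply/eqP; rewrite eq_complex /= !mul0r subr0 addr0 !eqxx.
Qed.

(** The argument of e^(zt) z^(alpha-1) dz on the ray of angle psi. *)
Definition phase (t alpha psi r : R) : R :=
  t * (r * sin psi) + (alpha - 1) * psi + psi.

Definition ray_integrand (t alpha psi : R) (Z : R[i] -> R[i]) (r : R) : R :=
  Im (cexp (t%:C * ray psi r) * cpow (ray psi r) (alpha - 1) * Z (ray psi r) * ray psi 1).

(** Polar form of the factor e^(zt) z^(alpha-1) dz: its modulus is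
[expkernel] and its argument is [phase]. *)
Lemma ray_integrandE (theta psi r t alpha : R) (Z : R[i] -> R[i]) :
  0 < theta < pi -> contour_angle theta psi -> 0 < r ->
  ray_integrand t alpha psi Z r = expkernel (- cos theta * t) alpha r *
    (cos (phase t alpha psi r) * Im (Z (ray psi r)) +
     sin (phase t alpha psi r) * Re (Z (ray psi r))).
Proof.
move=> ht hp r0; rewrite /ray_integrand (cpow_ray _ ht hp r0).
have cE : cos psi = cos theta by case: hp => ->; rewrite ?cosN.
have -> : expkernel (- cos theta * t) alpha r =
    expR (t * (r * cos psi)) * r `^ (alpha - 1).
  by rewrite /expkernel cE; congr (expR _ * _); ring.
rewrite /phase (cosD (_ + _)) (sinD (_ + _)) (cosD (t * _)) (sinD (t * _)).
case: (Z _) => a b; rewrite /cexp /ray /= !mul0r !subr0 !addr0.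
ring.
Qed.

Lemma two_pi_i_inv : (2 * pi%:C * 'i)^-1 = 0 +i* (- (2 * pi)^-1) :> R[i].
Proof.
apply: mulr1_eq; apply/eqP; rewrite eq_complex /=.
have p0 : (pi : R) != 0 by rewrite gt_eqF // pi_gt0.
apply/andP; split; apply/eqP; last by rewrite !(mulr0, mul0r, addr0, subr0, subrr).
by rewrite !(mulr0, mul0r, addr0, subr0, sub0r) mulr1 mulrN opprK -[1 + 1]/2%:R mulfV //
  mulf_neq0 // pnatr_eq0.
Qed.

(** Division by 2 pi i turns the real part of the solution into the imaginary part
of the contour integral. *)
Lemma contour_realE (theta : R) (g : R[i] -> R[i]) (u : R) :
  u%:C = (2 * pi%:C * 'i)^-1 * contour_integral theta g ->
  u = (2 * pi)^-1 *
   (\int[mu]_(r in posR) Im (g (ray theta r) * ray theta 1)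
   - \int[mu]_(r in posR) Im (g (ray (- theta) r) * ray (- theta) 1)).
Proof.
rewrite two_pi_i_inv /contour_integral /cintegral_pos.
move=> /(congr1 Re) e; rewrite -[LHS]/(Re u%:C) e /= mul0r sub0r mulNr opprK.
by [].
Qed.

(** The values of z^alpha along the ray of angle psi. *)
Definition ray_pow (alpha psi r : R) : R[i] :=
  (r `^ alpha * cos (alpha * psi)) +i* (r `^ alpha * sin (alpha * psi)).

(** On nonnegative numbers the inverse is the power of exponent -1. *)
Lemma measurable_funV_ge0 (D : set R) (f : R -> R) : (forall r, 0 <= f r) ->
  measurable_fun D f -> measurable_fun D (fun r => (f r)^-1).
Proof.
move=> f0 mf; apply: (eq_measurable_fun (fun r => f r `^ (-1))).
  by move=> r _; rewrite powR_inv1.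
by apply: (measurableT_comp (f := fun y : R => y `^ (-1))) => //; exact: measurable_powR.
Qed.

Lemma measurable_ray_resolvent (D : set R) (alpha psi l : R) :
  measurable_fun D (fun r => Re (ray_pow alpha psi r + l%:C)^-1) /\
  measurable_fun D (fun r => Im (ray_pow alpha psi r + l%:C)^-1).
Proof.
pose p r : R := r `^ alpha * cos (alpha * psi) + l.
pose q r : R := r `^ alpha * sin (alpha * psi).
have mpw : measurable_fun D (fun r : R => r `^ alpha).
  by apply: (@measurable_funS _ _ _ _ setT) => //; exact: measurable_powR.
have mq : measurable_fun D q by apply: measurable_funM.
have mp : measurable_fun D p by apply: measurable_funD => //; apply: measurable_funM.
have mn : measurable_fun D (fun r => (p r ^+ 2 + q r ^+ 2)^-1).
  apply: measurable_funV_ge0; first by move=> r; rewrite addr_ge0 ?sqr_ge0.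
  by apply: measurable_funD; apply: measurable_funX.
split.
  apply: (eq_measurable_fun (fun r => p r * (p r ^+ 2 + q r ^+ 2)^-1)).
    by move=> r _; rewrite /= addr0.
  exact: measurable_funM.
apply: (eq_measurable_fun (fun r => - (q r * (p r ^+ 2 + q r ^+ 2)^-1))).
  by move=> r _; rewrite /= addr0.
by apply: measurableT_comp => //; exact: measurable_funM.
Qed.

Lemma measurable_phase (D : set R) (t alpha psi : R) :
  measurable_fun D (fun r => cos (phase t alpha psi r)) /\
  measurable_fun D (fun r => sin (phase t alpha psi r)).
Proof.
have cph : continuous (fun r : R => t * (r * sin psi) + (alpha - 1) * psi + psi).
  move=> r; apply: cvgD; last exact: cvg_cst.
  apply: cvgD; last exact: cvg_cst.
  apply: cvgM; first exact: cvg_cst.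
  by apply: cvgM; [exact: cvg_id | exact: cvg_cst].
split; apply: (@measurable_funS _ _ _ _ setT) => //;
  apply: continuous_measurable_fun => r; apply: continuous_comp; try exact: cph.
- exact: continuous_cos.
- exact: continuous_sin.
Qed.

Section OnePart.
Variable part : R[i] -> R.
Hypotheses (partB : forall x y, part (x - y) = part x - part y)
  (partZ : forall z a, part (z * a%:C) = part z * a)
  (part_le : forall z, `|part z| <= normc z).
Variables (alpha psi : R).
Hypothesis mpart : forall l, measurable_fun posR (fun r => part (ray_pow alpha psi r + l%:C)^-1).
Hypotheses (s0 : 0 < `|sin (alpha * psi)|) (s1 : `|sin (alpha * psi)| <= 1).
Variables (c : nat -> R) (sigma S : R).
Hypotheses (sigma0 : 0 <= sigma)
  (cS : forall n, \sum_(1 <= k < n) lambda R k `^ sigma * c k ^+ 2 <= S).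

(** A pointwise limit of measurable partial sums. *)
Lemma measurable_exact_sum (x : R) :
  measurable_fun posR (fun r => exact_sum (ray_pow alpha psi r) part c x).
Proof.
apply: (measurable_fun_cvg (h := fun n r =>
  \sum_(1 <= k < n) part (exact_mode (ray_pow alpha psi r) c x k))).
  move=> n; apply: measurable_sum => k.
  apply: (eq_measurable_fun (fun r =>
      part (ray_pow alpha psi r + (lambda R k)%:C)^-1 * phi k x * c k)).
    by move=> r _; rewrite /exact_mode !partZ.
  by apply: measurable_funM => //; apply: measurable_funM.
move=> r _; have [] // := cvg_exact_sum s0 s1 (in_sector_polar (r `^ alpha) (alpha * psi)) partB
  partZ part_le sigma0 cS x.
Qed.

Lemma measurable_fd_sum (N : nat) (x : R) :
  measurable_fun posR (fun r => part (\sum_(1 <= k < N) fd_mode (ray_pow alpha psi r) c N x k)).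
Proof.
apply: (eq_measurable_fun (fun r =>
    \sum_(1 <= k < N) part (ray_pow alpha psi r + (fdmx_eig R N k)%:C)^-1 * c k * phi k x)).
  by move=> r _; rewrite part_sum //; apply: eq_bigr => k _; rewrite /fd_mode !partZ.
apply: measurable_sum => k.
by apply: measurable_funM => //; apply: measurable_funM.
Qed.

End OnePart.

(** The left-hand side is one coordinate of a rotation of (a1, a2). *)
Lemma rotation_sqr_le (b a1 a2 : R) :
  (cos b * a2 + sin b * a1) ^+ 2 <= a1 ^+ 2 + a2 ^+ 2.
Proof.
have -> : a1 ^+ 2 + a2 ^+ 2 = (cos b * a2 + sin b * a1) ^+ 2 + (cos b * a1 - sin b * a2) ^+ 2
   + (a1 ^+ 2 + a2 ^+ 2) * (1 - (cos b ^+ 2 + sin b ^+ 2)) by ring.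
by rewrite cos2Dsin2 subrr mulr0 addr0 lerDl sqr_ge0.
Qed.

Lemma rotation_abs_le (b a1 a2 B : R) : `|a1| <= B -> `|a2| <= B ->
  `|cos b * a2 + sin b * a1| <= 2 * B.
Proof.
move=> h1 h2; apply: le_trans (ler_normD _ _) _; rewrite !normrM.
have B0 : 0 <= B by apply: le_trans h1.
have := ler_pM (normr_ge0 _) (normr_ge0 _) (cos_max b) h2.
have := ler_pM (normr_ge0 _) (normr_ge0 _) (sin_max b) h1.
lra.
Qed.

Section RayError.
Variables (theta psi alpha : R).
Hypotheses (theta_range : 0 < theta < pi) (psiE : contour_angle theta psi).
Hypotheses (s0 : 0 < `|sin (alpha * psi)|).
Variables (c : nat -> R) (sigma S : R).
Hypotheses (sigma0 : 0 <= sigma)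
  (cS : forall n, \sum_(1 <= k < n) lambda R k `^ sigma * c k ^+ 2 <= S).

(** On one half-line, the error bound [E] for the resolvents, for real and
imaginary part alike, passes to the integrals.  The family of points is
arbitrary: all nodes for the l^2 norm, one node for the maximum norm. *)
Lemma ray_error (m N : nat) (x : 'I_m -> R) (t J E : R) (X Y : 'I_m -> R[i] -> R[i]) :
  (0 < N)%N -> 0 <= E ->
  (forall part w, part = Re \/ part = Im -> in_sector `|sin (alpha * psi)| w ->
    \sum_i (exact_sum w part c (x i) - part (\sum_(1 <= k < N) fd_mode w c N (x i) k)) ^+ 2
      <= E ^+ 2) ->
  (\int[mu]_(r in posR) (expkernel (- cos theta * t) alpha r)%:E <= J%:E)%E ->
  (forall i r, 0 < r -> X i (ray psi r) = cseries (exact_mode (ray_pow alpha psi r) c (x i))) ->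
  (forall i r, 0 < r -> Y i (ray psi r) =
     \sum_(1 <= k < N) fd_mode (ray_pow alpha psi r) c N (x i) k) ->
  \sum_i ((\int[mu]_(r in posR) ray_integrand t alpha psi (X i) r)%R -
      (\int[mu]_(r in posR) ray_integrand t alpha psi (Y i) r)%R) ^+ 2
    <= (2 * E * J) ^+ 2.
Proof.
move=> N0 E0 hE hJ hX hY; set g := ray_integrand t alpha psi.
have s1 : `|sin (alpha * psi)| <= 1 by exact: sin_max.
have sec r := in_sector_polar (r `^ alpha) (alpha * psi).
have pos r : posR r -> 0 < r by rewrite /= in_itv /= andbT.
pose m_ := expkernel (- cos theta * t) alpha.
pose L part i r := exact_sum (ray_pow alpha psi r) part c (x i).
pose F part i r := part (\sum_(1 <= k < N) fd_mode (ray_pow alpha psi r) c N (x i) k) : R.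
pose U (K : (R[i] -> R) -> 'I_m -> R -> R) i r := m_ r *
  (cos (phase t alpha psi r) * K Im i r + sin (phase t alpha psi r) * K Re i r).
have XE i : (\int[mu]_(r in posR) g (X i) r)%R = (\int[mu]_(r in posR) U L i r)%R.
  apply: eq_Rintegral => r; rewrite inE => /pos r0.
  by rewrite /g (ray_integrandE _ _ _ theta_range psiE r0) hX.
have YE i : (\int[mu]_(r in posR) g (Y i) r)%R = (\int[mu]_(r in posR) U F i r)%R.
  apply: eq_Rintegral => r; rewrite inE => /pos r0.
  by rewrite /g (ray_integrandE _ _ _ theta_range psiE r0) hY.
under eq_bigr do rewrite XE YE.
have mm : measurable_fun posR m_ by exact: measurable_expkernel.
have [mc ms] := measurable_phase posR t alpha psi.
have mU K : (forall i, measurable_fun posR (K Re i)) -> (forall i, measurable_fun posR (K Im i)) ->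
    forall i, measurable_fun posR (U K i).
  move=> mR mI i; apply: measurable_funM => //.
  by apply: measurable_funD; apply: measurable_funM.
have mRe l := (measurable_ray_resolvent posR alpha psi l).1.
have mIm l := (measurable_ray_resolvent posR alpha psi l).2.
pose B := 2 * Num.sqrt (4 * (`|sin (alpha * psi)| ^+ 2)^-1 ^+ 2 * 2 * S).
have bd part i r : part = Re \/ part = Im -> `|L part i r| <= B /\ `|F part i r| <= B.
  by case=> ->; [apply: (exact_fd_sum_bound s0 s1 (sec r) ReB ReM_real Re_le_normc sigma0 cS)
               | apply: (exact_fd_sum_bound s0 s1 (sec r) ImB ImM_real Im_le_normc sigma0 cS)].
have UB K : (forall part i r, part = Re \/ part = Im -> `|K part i r| <= B) ->
    forall i r, posR r -> `|U K i r| <= 2 * B * m_ r.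
  move=> hK i r _; rewrite /U normrM (ger0_norm (expkernel_ge0 _ _ _)) mulrC.
  rewrite ler_wpM2r ?expkernel_ge0 //.
  by apply: rotation_abs_le; apply: hK; [left | right].
apply: (@Rintegral_l2_le _ _ R mu m posR m_ (U L) (U F) (2 * B) (2 * E) J) => //.
- by move=> r _; exact: expkernel_ge0.
- apply: mU => i.
    exact: (measurable_exact_sum ReB ReM_real Re_le_normc mRe s0 s1 sigma0 cS).
  exact: (measurable_exact_sum ImB ImM_real Im_le_normc mIm s0 s1 sigma0 cS).
- apply: mU => i.
    exact: (measurable_fd_sum ReB ReM_real mRe).
  exact: (measurable_fd_sum ImB ImM_real mIm).
- by apply: UB => part i r /(bd _ i r)[].
- by apply: UB => part i r /(bd _ i r)[].
- by rewrite mulr_ge0.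
- move=> r _.
  apply: (@le_trans _ _ (\sum_i m_ r ^+ 2 * ((L Re i r - F Re i r) ^+ 2 +
      (L Im i r - F Im i r) ^+ 2))).
    apply: ler_sum => i _; rewrite /U -mulrBr exprMn ler_wpM2l ?sqr_ge0 //.
    apply: le_trans (rotation_sqr_le (phase t alpha psi r) _ _).
    by rewrite le_eqVlt; apply/orP; left; apply/eqP; congr (_ ^+ 2); ring.
  rewrite -mulr_sumr big_split /= [leRHS]exprMn [leLHS]mulrC ler_wpM2r ?sqr_ge0 //.
  have hR := hE Re _ (or_introl erefl) (sec r).
  have hI := hE Im _ (or_intror erefl) (sec r).
  rewrite exprMn; apply: le_trans (lerD hR hI) _.
  by have := sqr_ge0 E; lra.
Qed.

End RayError.

End Contour.

(** * Error of the scheme *)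

Section SchemeError.
Local Open Scope complex_scope.
Variable R : realType.
Local Notation mu := (@lebesgue_measure R).
Local Notation posR := (`]0%R, +oo[%classic : set R).

Lemma innerC (v w : R -> R) : inner v w = inner w v.
Proof. by apply: eq_Rintegral => x _; rewrite mulrC. Qed.

Lemma inner_phi0 (v : R -> R) : inner v (phi 0) = 0.
Proof.
rewrite /inner; under eq_Rintegral do rewrite phi_index0 mulr0.
by rewrite /Rintegral integral0.
Qed.

(** All estimates are made on partial sums of the series that defines the norm,
and refer to the initial value through this bound. *)
Lemma Hhat_partial_le (sigma : R) (v : R -> R) : Hhat sigma v -> forall n,
  \sum_(1 <= k < n) lambda R k `^ sigma * inner v (phi k) ^+ 2
    <= fine (Hhat_sqnorm sigma v).
Proof.
move=> [_ fin] n.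
have t0 k : (0 <= (lambda R k `^ sigma * inner v (phi k) ^+ 2)%:E)%E.
  by rewrite lee_fin mulr_ge0 ?powR_ge0 ?sqr_ge0.
have S0 : (0 <= Hhat_sqnorm sigma v)%E by apply: nneseries_ge0 => k _ _; exact: t0.
rewrite -lee_fin fineK; last by rewrite ge0_fin_numE.
by rewrite -sumEFin; apply: nneseries_lim_ge => k _ _; exact: t0.
Qed.

Section FixedTime.
Variables (theta alpha : R).
Hypotheses (theta_range : 0 < theta < pi) (sin_pos : 0 < sin (alpha * theta)).
Variables (u0 : R -> R) (sigma S : R).
Let c k := inner u0 (phi k).
Let c0 : c 0%N = 0. Proof. exact: inner_phi0. Qed.
Hypotheses (sigma0 : 0 <= sigma)
  (cS : forall n, \sum_(1 <= k < n) lambda R k `^ sigma * c k ^+ 2 <= S).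

Lemma sin_contour (psi : R) : contour_angle theta psi ->
  `|sin (alpha * psi)| = sin (alpha * theta).
Proof. by case=> ->; rewrite ?mulrN ?sinN ?normrN gtr0_norm. Qed.

Let Xf (x : R) (z : R[i]) := cseries (fun k => (cpow z alpha + (lambda R k)%:C)^-1
                        * (phi k x)%:C * (inner (phi k) u0)%:C).

(** Both half-lines obey the bound of [ray_error]; the factor 1 / (2 pi) makes up
for there being two of them. *)
Lemma contour_error (m N : nat) (x u v : 'I_m -> R) (t J E : R)
    (Y : 'I_m -> R[i] -> R[i]) :
  (0 < N)%N -> 0 <= E ->
  (forall part w, part = @complex.Re R \/ part = @complex.Im R ->
    in_sector (sin (alpha * theta)) w ->
    \sum_i (exact_sum w part c (x i) - part (\sum_(1 <= k < N) fd_mode w c N (x i) k)) ^+ 2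
      <= E ^+ 2) ->
  (\int[mu]_(r in posR) (expkernel (- cos theta * t) alpha r)%:E <= J%:E)%E ->
  (forall i psi r, contour_angle theta psi -> 0 < r -> Y i (ray psi r) =
     \sum_(1 <= k < N) fd_mode (cpow (ray psi r) alpha) c N (x i) k) ->
  (forall i, (u i)%:C = (2 * pi%:C * 'i)^-1 * contour_integral theta (fun z =>
     cexp (t%:C * z) * cpow z (alpha - 1) * Xf (x i) z)) ->
  (forall i, (v i)%:C = (2 * pi%:C * 'i)^-1 * contour_integral theta (fun z =>
     cexp (t%:C * z) * cpow z (alpha - 1) * Y i z)) ->
  \sum_i (u i - v i) ^+ 2 <= (2 * E * J) ^+ 2.
Proof.
move=> N0 E0 hE hJ hY hu hv.
have ray_le psi : contour_angle theta psi ->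
    \sum_i ((\int[mu]_(r in posR) ray_integrand t alpha psi (Xf (x i)) r)%R -
      (\int[mu]_(r in posR) ray_integrand t alpha psi (Y i) r)%R) ^+ 2 <= (2 * E * J) ^+ 2.
  move=> hpsi; have sE := sin_contour hpsi.
  apply: (ray_error (N := N) (X := fun i => Xf (x i)) theta_range hpsi _ sigma0 cS N0 E0 _ hJ).
  - by rewrite sE.
  - by move=> part w hp; rewrite sE; exact: hE.
  - move=> i r r0; rewrite /Xf (cpow_ray _ theta_range hpsi r0).
    by congr cseries; apply/funext => k; rewrite /exact_mode (innerC (phi k)).
  - by move=> i r r0; rewrite hY // (cpow_ray _ theta_range hpsi r0).
have h1 := ray_le theta (or_introl erefl).
have h2 := ray_le (- theta) (or_intror erefl).
have [p0 p2] : 0 < (2 * pi : R)^-1 /\ (2 * pi : R)^-1 <= 4^-1.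
  have := pi_ge2 R => p2; have := pi_gt0 R => p0.
  by rewrite invr_gt0 mulr_gt0 // lef_pV2 ?posrE ?mulr_gt0 //; split=> //; lra.
pose I psi Z := (\int[mu]_(r in posR) ray_integrand t alpha psi Z r)%R.
pose a i := I theta (Xf (x i)) - I theta (Y i).
pose b i := I (- theta) (Xf (x i)) - I (- theta) (Y i).
apply: (@le_trans _ _ (\sum_i (a i ^+ 2 + b i ^+ 2) / 2)); last first.
  rewrite -mulr_suml big_split /= ler_pdivrMr // mulr_natr mulr2n; exact: lerD.
(* (2 pi)^-2 <= 1/16, while (a - b)^2 <= 2 (a^2 + b^2). *)
apply: ler_sum => i _.
have -> : u i - v i = (2 * pi)^-1 * (a i - b i).
  rewrite (contour_realE (hu i)) (contour_realE (hv i)) -mulrBr; congr (_ * _).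
  by rewrite /a /b /I /ray_integrand; ring.
rewrite exprMn; set p := (2 * pi)^-1 in p0 p2 *.
have pp : p ^+ 2 <= 4^-1.
  have : p ^+ 2 <= 4^-1 * p by rewrite expr2 ler_wpM2r // ltW.
  by move=> h; apply: le_trans h _; rewrite ler_piMr //; lra.
apply: (@le_trans _ _ (4^-1 * (a i - b i) ^+ 2)); first by rewrite ler_wpM2r ?sqr_ge0.
have := sqr_ge0 (a i + b i).
have -> : (a i - b i) ^+ 2 = 2 * (a i ^+ 2 + b i ^+ 2) - (a i + b i) ^+ 2 by ring.
lra.
Qed.

Let s := sin (alpha * theta).
Let K := (s ^+ 2)^-1.

Let s1 : s <= 1. Proof. exact: sin_le1. Qed.

Let K0 : 0 < K. Proof. by rewrite invr_gt0 exprn_gt0. Qed.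

Definition node (n : nat) (i : 'I_n) : R := i.+1%:R / n.+1%:R.

(** The initial vector of the scheme has no modes k >= N, so
[fdmx_resolvent] applies to it. *)
Lemma scheme_resolventE (n : nat) (i : 'I_n) (psi r : R) :
  contour_angle theta psi -> 0 < r ->
  (invmx ((cpow (ray psi r) alpha)%:M + map_mx (real_complex R) (fdmx R n.+1)) *m
     map_mx (real_complex R) (interp n.+1 (L2proj n.+1 u0))) i 0 =
  \sum_(1 <= k < n.+1) fd_mode (cpow (ray psi r) alpha) c n.+1 (node i) k.
Proof.
move=> hpsi r0; rewrite (fdmx_resolvent c) // => k kn.
rewrite (cpow_ray _ theta_range hpsi r0).
have hs := in_sector_polar (r `^ alpha) (alpha * psi).
rewrite (sin_contour hpsi) in hs.
by apply: (sector_neq0 sin_pos hs); rewrite fdmx_eig_gt0.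
Qed.

Section Nodes.
Variables (T t J : R) (n : nat) (u : R -> R -> R) (uh : R -> 'cV[R]_(n.+1.-1)).
Hypotheses (t_range : 0 < t <= T) (J0 : 0 <= J).
Hypothesis hJ : (\int[mu]_(r in posR) (expkernel (- cos theta * t) alpha r)%:E <= J%:E)%E.
Hypotheses (hu : subdiffusion_solution T alpha theta u0 u)
  (huh : scheme_solution T alpha theta u0 uh).

Let e (i : 'I_n) := u (node i) t - uh t i 0.

Lemma nodal_error_le (m : nat) (pick : 'I_m -> 'I_n) (E : R) : 0 <= E ->
  (forall part w, part = @complex.Re R \/ part = @complex.Im R -> in_sector s w ->
    \sum_i (exact_sum w part c (node (pick i)) -
       part (\sum_(1 <= k < n.+1) fd_mode w c n.+1 (node (pick i)) k)) ^+ 2 <= E ^+ 2) ->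
  \sum_(i < m) e (pick i) ^+ 2 <= (2 * E * J) ^+ 2.
Proof.
move=> E0 hE.
have nodeI (i : 'I_n) : 0 <= node i <= 1.
  rewrite divr_ge0 //= ler_pdivrMr // mul1r ler_nat; exact: ltnW (ltn_ord i).
apply: (contour_error (N := n.+1) (x := fun i => node (pick i)) (t := t)
  (Y := fun i z => (invmx ((cpow z alpha)%:M + map_mx (real_complex R) (fdmx R n.+1)) *m
     map_mx (real_complex R) (interp n.+1 (L2proj n.+1 u0))) (pick i) 0) _ E0 hE hJ) => //.
- by move=> i psi r; exact: scheme_resolventE.
- by move=> i; apply: hu.
- by move=> i; apply: huh.
Qed.

Lemma nodal_error_linf (CT : R) (i : 'I_n) : 0 <= CT ->
  (forall k, \sum_(1 <= j < k) mode_weight sigma n.+1 j <= CT * linf_rate sigma n.+1 ^+ 2) ->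
  `|e i| <= 4 * K * Num.sqrt CT * J * linf_rate sigma n.+1 * Num.sqrt S.
Proof.
move=> CT0 hT.
have S0 : 0 <= S by apply: le_trans (cS 0%N); rewrite big_geq.
have rate0 : 0 <= linf_rate sigma n.+1 by rewrite mulr_ge0 // powR_ge0.
pose E := 2 * K * Num.sqrt CT * linf_rate sigma n.+1 * Num.sqrt S.
have E0 : 0 <= E by rewrite mulr_ge0 ?sqrtr_ge0 // !mulr_ge0 ?sqrtr_ge0 ?powR_ge0 ?(ltW K0).
have EE : E ^+ 2 = 4 * K ^+ 2 * (CT * linf_rate sigma n.+1 ^+ 2) * S.
  by rewrite -[in RHS](sqr_sqrtr CT0) -[in RHS](sqr_sqrtr S0); rewrite /E; ring.
have := nodal_error_le (m := 1) (pick := fun=> i) E0; rewrite big_ord1 => h.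
have -> : 4 * K * Num.sqrt CT * J * linf_rate sigma n.+1 * Num.sqrt S = 2 * E * J.
  by rewrite /E; ring.
rewrite -(ler_pXn2r (n := 2)) ?nnegrE //; last by rewrite mulr_ge0 // mulr_ge0.
rewrite real_normK ?num_real //; apply: h => part w hp hw; rewrite big_ord1 EE.
case: hp => ->.
  exact: (resolvent_error_linf sin_pos s1 hw (@ReB R) (@ReM_real R) (@Re_le_normc R)
    sigma0 cS (node i) (ltn0Sn n) hT).
exact: (resolvent_error_linf sin_pos s1 hw (@ImB R) (@ImM_real R) (@Im_le_normc R)
  sigma0 cS (node i) (ltn0Sn n) hT).
Qed.

Lemma nodal_error_l2 :
  n%:R^-1 * \sum_i e i ^+ 2 <= 64 * ((K * n.+1%:R^-1 ^+ 2 * J) ^+ 2 * S).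
Proof.
have S0 : 0 <= S by apply: le_trans (cS 0%N); rewrite big_geq.
have X0 : 0 <= (K * n.+1%:R^-1 ^+ 2 * J) ^+ 2 * S by rewrite mulr_ge0 // sqr_ge0.
have [n0|n0] := posnP n.
  rewrite big1; first by rewrite mulr0 mulr_ge0.
  by move=> i; have := ltn_ord i; rewrite {2}n0.
have nR : 0 < n%:R :> R by rewrite ltr0n.
pose E := Num.sqrt (8 * n.+1%:R * (K / n.+1%:R ^+ 2) ^+ 2 * S).
have B0 : 0 <= 8 * n.+1%:R * (K / n.+1%:R ^+ 2) ^+ 2 * S.
  by rewrite mulr_ge0 // mulr_ge0 ?sqr_ge0.
have E2 : E ^+ 2 = 8 * n.+1%:R * (K / n.+1%:R ^+ 2) ^+ 2 * S by exact: sqr_sqrtr.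
have h1 : \sum_(i < n) e i ^+ 2 <= (2 * E * J) ^+ 2.
  apply: (nodal_error_le (pick := id)); first exact: sqrtr_ge0.
  move=> part w hp hw; rewrite E2.
  case: hp => ->.
    exact: (resolvent_error_l2 sin_pos s1 hw (@ReB R) (@ReM_real R) (@Re_le_normc R) c0 sigma0 cS).
  exact: (resolvent_error_l2 sin_pos s1 hw (@ImB R) (@ImM_real R) (@Im_le_normc R) c0 sigma0 cS).
apply: (@le_trans _ _ (n%:R^-1 * (2 * E * J) ^+ 2)).
  by rewrite ler_wpM2l // invr_ge0 ltW.
have -> : n%:R^-1 * (2 * E * J) ^+ 2 =
    (n.+1%:R / n%:R) * 32 * ((K * n.+1%:R^-1 ^+ 2 * J) ^+ 2 * S).
  have -> : (2 * E * J) ^+ 2 = 4 * E ^+ 2 * J ^+ 2 by ring.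
  rewrite E2; move: n.+1%:R (ltr0Sn R n) => x x0.
  by field; rewrite !gt_eqF.
rewrite ler_wpM2r //; have -> : 64 = 2 * 32 :> R by ring.
by rewrite ler_wpM2r // ler_pdivrMr // -natrM ler_nat mul2n -addnn -addn1 leq_add2l.
Qed.

End Nodes.

End FixedTime.
End SchemeError.

Theorem theorem3 (R : realType) (T alpha sigma theta : R)
  (T_gt0 : 0 < T) (alpha01 : 0 < alpha < 1) (sigma_ge0 : 0 <= sigma)
  (theta_range : pi / 2 < theta < pi) :
  exists2 C : R, 0 < C &
    forall (u0 : R -> R), Hhat sigma u0 ->
    forall (u : R -> R -> R), subdiffusion_solution T alpha theta u0 u ->
    forall (N : nat), (0 < N)%N ->
    forall (uh : R -> 'cV[R]_(N.-1)), scheme_solution T alpha theta u0 uh ->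
    forall t : R, 0 < t <= T ->
      let h : R := N%:R^-1 in
      norm_linf (interp N (u ^~ t) - uh t)
        <= C * h `^ (Num.min (sigma + 3 / 2) 2)
             * ell h `^ (chi0 (1 / 4 - sigma / 2))
             * t `^ (- alpha) * Hhat_norm sigma u0
      /\ norm_l2 (interp N (u ^~ t) - uh t)
        <= C * h ^+ 2 * t `^ (- alpha) * Hhat_norm sigma u0.
Proof.
have pi0 := pi_gt0 R.
have theta_pos : 0 < theta < pi by move: theta_range => /andP[h1 ->]; rewrite andbT; lra.
have rho0 : 0 < - cos theta.
  have := @sin_gt0_pihalf R (theta - pi / 2); rewrite sinBpihalf; apply.
  by move: theta_range => /andP[h1 h2]; lra.
set s := sin (alpha * theta).
have s0 : 0 < s.
  apply: sin_gt0_pi; move: theta_pos alpha01 => /andP[th0 thp] /andP[a0 a1].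
  by rewrite mulr_gt0 //=; apply: lt_trans thp; rewrite gtr_pMl.
have alpha1 : 0 < alpha <= 1 by move: alpha01 => /andP[-> /ltW].
have [C0 C0pos HC0] := expkernel_integral_le rho0 alpha1.
have [CT CTpos HCT] := sum_mode_weight_le sigma_ge0.
pose K := (s ^+ 2)^-1.
have K0 : 0 < K by rewrite invr_gt0 exprn_gt0.
have CT1 : 0 <= Num.sqrt CT by exact: sqrtr_ge0.
(* The l^2 bound needs 8 K C0 and the maximum-norm bound 4 K C0 sqrt CT. *)
pose C := 8 * K * C0 * (1 + Num.sqrt CT).
have Cpos : 0 < C by rewrite !mulr_gt0 // ltr_pwDl.
exists C => //.
move=> u0 hu0 u hu [//|n] _ uh huh t t_range h.
have /andP[t0 _] := t_range.
have cS := Hhat_partial_le hu0; set S := fine (Hhat_sqnorm sigma u0) in cS.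
have S0 : 0 <= S by apply: le_trans (cS 0%N); rewrite big_geq.
pose J := C0 * t `^ (- alpha).
have J0 : 0 <= J by rewrite mulr_ge0 ?powR_ge0 // ltW.
have hJ := HC0 t t0; rewrite -/J in hJ.
have eE : interp n.+1 (u ^~ t) - uh t = \col_i (u (node R i) t - uh t i 0).
  by apply/colP => i; rewrite !mxE.
rewrite eE; split.
- apply/bigmax_leP; split.
    rewrite mulr_ge0 ?sqrtr_ge0 // mulr_ge0 ?powR_ge0 // mulr_ge0 ?powR_ge0 //.
    by rewrite mulr_ge0 ?powR_ge0 // ltW.
  move=> i _; rewrite mxE.
  (* N = 1 has no interior node, so here N >= 2. *)
  have n0 : (0 < n)%N by case: (n) i => [[]|].
  apply: le_trans (nodal_error_linf theta_pos s0 sigma_ge0 cS t_range J0 hJ hu huh i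
    (ltW CTpos) (fun k => HCT n.+1 k n0)) _.
  rewrite -[_ * _ `^ (chi0 _)]mulrA -/(linf_rate sigma n.+1) /Hhat_norm -/S -/s -/K.
  pose X := K * C0 * (linf_rate sigma n.+1 * t `^ (- alpha) * Num.sqrt S).
  have X0 : 0 <= X by rewrite !mulr_ge0 ?powR_ge0 ?sqrtr_ge0 ?(ltW K0) ?(ltW C0pos).
  have -> : 4 * K * Num.sqrt CT * J * linf_rate sigma n.+1 * Num.sqrt S = 4 * Num.sqrt CT * X.
    by rewrite /J /X; ring.
  have -> : C * linf_rate sigma n.+1 * t `^ (- alpha) * Num.sqrt S =
      8 * (1 + Num.sqrt CT) * X by rewrite /C /X; ring.
  by rewrite ler_wpM2r //; move: (Num.sqrt CT) CT1 => q q0; clear -q0; lra.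
- have CB : 0 <= C * h ^+ 2 * t `^ (- alpha) * Hhat_norm sigma u0.
    rewrite mulr_ge0 ?sqrtr_ge0 // mulr_ge0 ?powR_ge0 // mulr_ge0 ?sqr_ge0 //.
    exact: ltW.
  rewrite /norm_l2 -[leRHS]ger0_norm // -sqrtr_sqr ler_wsqrtr //.
  under eq_bigr do rewrite mxE.
  apply: le_trans (nodal_error_l2 theta_pos s0 sigma_ge0 cS t_range hJ hu huh) _.
  have H2 : Hhat_norm sigma u0 ^+ 2 = S by exact: sqr_sqrtr.
  rewrite -/s -/K.
  have -> : (C * h ^+ 2 * t `^ (- alpha) * Hhat_norm sigma u0) ^+ 2 =
      (1 + Num.sqrt CT) ^+ 2 * (64 * ((K * h ^+ 2 * J) ^+ 2 * S)).
    by rewrite -H2 /C /J; ring.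
  have q1 : 1 <= (1 + Num.sqrt CT) ^+ 2 by rewrite expr_ge1 ?addr_ge0 // lerDl.
  by rewrite ler_peMl // mulr_ge0 // mulr_ge0 // sqr_ge0.
Qed.
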